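(* Let $Z$ be a bivector field on a manifold $M$. There is an open subset $\mathcal{U}\subset\mathcal{I}_Z$, which contains the zero section of $\wedge^2T^*M$, such that a $2$-form $\beta\in\Gamma(\mathcal{U})$ is a Maurer-Cartan element of $(\Omega(M)[2],\lambda_1,\lambda_2,\lambda_3)$, i.e. $$d(\beta[2])+\tfrac12\lambda_2(\beta[2]\odot\beta[2])+\tfrac16\lambda_3(\beta[2]\odot\beta[2]\odot\beta[2])=0,$$ if, and only if, the $2$-form $F(\beta)$ is closed.
   Context: For a $2$-form $\beta$, $\beta^\sharp(v)=\iota_v\beta$; $Z^\sharp\colon T^*M\to TM$, $\xi\mapsto Z(\xi,\cdot)$. $\mathcal{I}_Z\subset\wedge^2T^*M$ is the set of those $\beta$ for which $\mathrm{id}+Z^\sharp\beta^\sharp$ is invertible, and $F\colon\mathcal{I}_Z\to\wedge^2T^*M$ is determined by $(F(\beta))^\sharp=\beta^\sharp(\mathrm{id}+Z^\sharp\beta^\sharp)^{-1}$. $\Omega(M)[2]$ has degree $k$ component $\Omega^{k+2}(M)$. Cartan calculus: $\iota_X\omega=\omega(X,\cdot,\dots,\cdot)$, $\iota_{X\wedge\tilde X}=\iota_X\circ\iota_{\tilde X}$; for a $k$-vector field $Y$, $\mathcal{L}_Y=\iota_Y\circ d-(-1)^kd\circ\iota_Y$; the Schouten-Nijenhuis bracket is normalized by $[\mathcal{L}_Y,\iota_{\tilde Y}]=\iota_{[Y,\tilde Y]}$. For forms, $\alpha^\sharp(v)=\iota_v\alpha$ and $(\alpha_1^\sharp\wedge\alpha_2^\sharp\wedge\alpha_3^\sharp)(v_1\wedge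 v_2\wedge v_3)=\sum_{\sigma\in S_3}(-1)^{|\sigma|}\alpha_1^\sharp(v_{\sigma(1)})\wedge\alpha_2^\sharp(v_{\sigma(2)})\wedge\alpha_3^\sharp(v_{\sigma(3)})$. The maps are $\lambda_1=d$, $\lambda_2(\alpha[2]\odot\beta[2])=-(\mathcal{L}_Z(\alpha\wedge\beta)-\mathcal{L}_Z(\alpha)\wedge\beta-(-1)^{|\alpha|}\alpha\wedge\mathcal{L}_Z(\beta))[2]$, $\lambda_3(\alpha[2]\odot\beta[2]\odot\gamma[2])=(-1)^{|\beta|+1}((\alpha^\sharp\wedge\beta^\sharp\wedge\gamma^\sharp)(\frac12[Z,Z]))[2]$; they form an $L_\infty[1]$-algebra structure. *)

(* Defs.v *)
From HB Require Import structures.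
From mathcomp Require Import all_boot all_order all_fingroup all_algebra.
From mathcomp Require Import all_classical all_reals all_analysis.
Set Implicit Arguments.
Unset Strict Implicit.
Unset Printing Implicit Defensive.
Import Order.TTheory GRing.Theory Num.Theory.
Import numFieldNormedType.Exports.
Local Open Scope classical_set_scope.
Local Open Scope ring_scope.

Section SmoothFunctions.
Variables (R : realType) (n : nat) (V : normedModType R).

(* Differentiability is required along with the partial derivatives, so that
   no separate argument is needed to get it from their continuity. *)
Fixpoint Ck (k : nat) (D : set 'rV[R]_n) (f : 'rV[R]_n -> V) : Prop :=
  match k with
  | 0 => forall x, D x -> {for x, continuous f}
  | k'.+1 => (forall x, D x -> differentiable f x) /\
             forall i : 'I_n, Ck k' D (fun x => 'D_(delta_mx 0 i) f x)
  end.

(* Meant for an open [D]; values of [f] outside [D] are irrelevant. *)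
Definition smooth_on (D : set 'rV[R]_n) (f : 'rV[R]_n -> V) : Prop :=
  forall k, Ck k D f.

End SmoothFunctions.

(* [chart_at] selects one chart of the atlas around each point.  The tangent
   space at [x] is 'rV_n, a tangent vector being given by its components in
   [chart_at x]; likewise a cotangent vector is a column of components in
   [chart_at x], and the pairing is [v *m xi]. *)
Record smooth_manifold (R : realType) (n : nat) := SmoothManifold {
  carrier :> topologicalType;
  chart : Type;
  cdom : chart -> set carrier;
  crng : chart -> set 'rV[R]_n;
  ccoord : chart -> carrier -> 'rV[R]_n;
  cparam : chart -> 'rV[R]_n -> carrier;
  chart_at : carrier -> chart;
  manifold_hausdorff : hausdorff_space carrier;
  manifold_second_countable : @second_countable carrier;
  cdom_open : forall i, open (cdom i);
  crng_open : forall i, open (crng i);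
  coord_crng : forall i x, cdom i x -> crng i (ccoord i x);
  param_cdom : forall i y, crng i y -> cdom i (cparam i y);
  coordK : forall i x, cdom i x -> cparam i (ccoord i x) = x;
  paramK : forall i y, crng i y -> ccoord i (cparam i y) = y;
  coord_continuous : forall i x, cdom i x -> {for x, continuous (ccoord i)};
  param_continuous : forall i y, crng i y -> {for y, continuous (cparam i)};
  chart_atP : forall x, cdom (chart_at x) x;
  transition_smooth : forall i j,
    smooth_on (crng i `&` cparam i @^-1` cdom j) (ccoord j \o cparam i)
}.

Section Exterior.
Variables (R : realType) (n : nat).

(* Elements of the exterior algebras of the dual of a vector space are functions
   on finite sequences of vectors.  Those of degree [k] vanish on sequences of
   length other than [k], so operators of any degree act on a single type. *)
Definition alternating (V : lmodType R) (k : nat) (b : seq V -> R) : Prop :=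
  [/\ forall s, size s != k -> b s = 0,
      forall s1 s2 (a : R) (u v : V),
        b (s1 ++ (a *: u + v) :: s2) = a * b (s1 ++ u :: s2) + b (s1 ++ v :: s2)
    & forall s1 s2 s3 (u : V), b (s1 ++ u :: s2 ++ u :: s3) = 0].

Definition covec := seq 'rV[R]_n -> R.
Definition mvec := seq 'cV[R]_n -> R.

Definition ebasis (i : 'I_n) : 'rV[R]_n := delta_mx 0 i.
Definition dbasis (i : 'I_n) : 'cV[R]_n := delta_mx i 0.

Definition mask_inversions (k : nat) (m : k.-tuple bool) : nat :=
  #|[pred p : 'I_k * 'I_k | [&& (p.1 < p.2)%N, ~~ tnth m p.1 & tnth m p.2]]|.

(* Sum over shuffles, i.e. over the subsets of positions handed to [a]; hence
   (xi1 /\ xi2)(v1, v2) = xi1(v1) xi2(v2) - xi1(v2) xi2(v1). *)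
Definition ext_wedge (a b : covec) : covec := fun s =>
  \sum_(m : (size s).-tuple bool)
    (-1) ^+ mask_inversions m * a (mask m s) * b (mask (map negb m) s).

Definition covec1 : covec := fun s => (nilp s)%:R.

Definition covec_of (xi : 'cV[R]_n) : covec := fun s =>
  if s is [:: v] then (v *m xi) 0 0 else 0.

Definition insert (v : 'rV[R]_n) (w : covec) : covec := fun s => w (v :: s).

(* With X1 /\ ... /\ Xk normalized by determinants, a k-vector is
   y = 1/k! sum_I y(dx^i1, ..., dx^ik) e_i1 /\ ... /\ e_ik, and
   insertion of e_i1 /\ ... /\ e_ik is insert e_i1 \o ... \o insert e_ik. *)
Definition insertk (k : nat) (y : mvec) (w : covec) : covec := fun s =>
  (k`!%:R)^-1 * \sum_(I : k.-tuple 'I_n)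
     y [seq dbasis i | i <- I] * foldr (fun i => insert (ebasis i)) w I s.

(* (a^# /\ b^# /\ c^#)(y), extended linearly from decomposable trivectors. *)
Definition sharp3 (a b c : covec) (y : mvec) : covec := fun s =>
  (3`!%:R)^-1 * \sum_(I : 3.-tuple 'I_n) y [seq dbasis i | i <- I] *
    \sum_(sg : 'S_3)
      let v (k : 'I_3) := ebasis (tnth I (sg k)) in
      (-1) ^+ sg *
      ext_wedge (insert (v (@Ordinal 3 0 isT)) a)
        (ext_wedge (insert (v (@Ordinal 3 1 isT)) b)
               (insert (v (@Ordinal 3 2 isT)) c)) s.

Definition flat2 (b : covec) (v : 'rV[R]_n) : 'cV[R]_n :=
  \col_j b [:: v; ebasis j].
Definition sharp2 (z : mvec) (xi : 'cV[R]_n) : 'rV[R]_n :=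
  \row_j z [:: xi; dbasis j].

(* Matrix, acting on row vectors from the right, of id + z^# b^#. *)
Definition id_plus (z : mvec) (b : covec) : 'M[R]_n :=
  lin1_mx (fun v => v + sharp2 z (flat2 b v)).

Definition I_fiber (z : mvec) : set covec :=
  [set b | alternating 2 b /\ id_plus z b \in unitmx].

(* (F b)^# = b^# (id + z^# b^#)^-1 *)
Definition F_fiber (z : mvec) (b : covec) : covec := fun s =>
  if s is [:: v; w] then (w *m flat2 b (v *m invmx (id_plus z b))) 0 0 else 0.

Definition covec_of_mx (B : 'M[R]_n) : covec := fun s =>
  if s is [:: v; w] then (v *m B *m w^T) 0 0 else 0.

End Exterior.

Section Manifold.
Variables (R : realType) (n : nat) (M : smooth_manifold R n).
Local Notation chart_at := (@chart_at R n M).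

(* Jacobian of the change of coordinates from chart [i] to chart [j], at a point
   given by its coordinates in [i]; components of vectors change by right
   multiplication, [v *m jac i j y]. *)
Definition jac (i j : chart M) (y : 'rV[R]_n) : 'M[R]_n :=
  'J (ccoord j \o cparam i) y.

(* Jacobian at [x] of the change from the preferred chart at [x] to [i]. *)
Definition jac_at (x : M) (i : chart M) : 'M[R]_n :=
  jac (chart_at x) i (ccoord (chart_at x) x).

Definition dform := M -> covec R n.
Definition mvfield := M -> mvec R n.

(* Local expressions in the chart [i], as functions of the coordinates. *)
Definition form_in (i : chart M) (w : dform) (y : 'rV[R]_n) : covec R n :=
  fun s => w (cparam i y) [seq v *m jac i (chart_at (cparam i y)) y | v <- s].
Definition mvfield_in (i : chart M) (Y : mvfield) (y : 'rV[R]_n) : mvec R n :=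
  fun s => Y (cparam i y) [seq jac_at (cparam i y) i *m xi | xi <- s].

Definition is_form (k : nat) (w : dform) : Prop :=
  (forall x, alternating k (w x)) /\
  forall i s, smooth_on (crng i) (fun y => form_in i w y s).
Definition is_mvfield (k : nat) (Y : mvfield) : Prop :=
  (forall x, alternating k (Y x)) /\
  forall i s, smooth_on (crng i) (fun y => mvfield_in i Y y s).

(* The de Rham differential, computed at [x] in the chart [chart_at x]. *)
Definition ext_d (w : dform) : dform := fun x s =>
  \sum_(j < size s) (-1) ^+ j *
    'D_(s`_j) (fun y => form_in (chart_at x) w y (take j s ++ drop j.+1 s))
      (ccoord (chart_at x) x).

Definition wedgef (a b : dform) : dform := fun x => ext_wedge (a x) (b x).

Definition iotaf (k : nat) (Y : mvfield) (w : dform) : dform :=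
  fun x => insertk k (Y x) (w x).

Definition lie_der (k : nat) (Y : mvfield) (w : dform) : dform := fun x s =>
  iotaf k Y (ext_d w) x s - (-1) ^+ k * ext_d (iotaf k Y w) x s.

(* Graded commutator of lie_der k Y, of degree 1 - k, and iotaf l Y', of degree
   - l; the parity of (1 - k) * (- l) is that of k.+1 * l. *)
Definition comm_lie_iota (k : nat) (Y : mvfield) (l : nat) (Y' : mvfield)
    (w : dform) : dform := fun x s =>
  lie_der k Y (iotaf l Y' w) x s - (-1) ^+ (k.+1 * l) * iotaf l Y' (lie_der k Y w) x s.

(* The form on the domain of [chart_at x] whose components in that chart are
   constantly those of [w]; its values elsewhere are irrelevant. *)
Definition const_form (x : M) (w : covec R n) : dform := fun y s =>
  w [seq v *m jac_at y (chart_at x) | v <- s].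

(* The Schouten-Nijenhuis bracket of a k- and an l-vector field, read off from
   [L_Y, iota_Y'] = iota_[Y, Y'].  By the convention for insertions, the
   insertion of an m-vector W into xi_m /\ ... /\ xi_1 is
   W(xi_1, ..., xi_m), whence the order reversal. *)
Definition schouten (k : nat) (Y : mvfield) (l : nat) (Y' : mvfield) : mvfield :=
  fun x xis =>
    let w := foldr (@ext_wedge R n) (@covec1 R n) [seq covec_of xi | xi <- rev xis] in
    comm_lie_iota k Y l Y' (const_form x w) x [::].

(* The shift [2] is left implicit: elements of Omega(M)[2] are forms, and [p],
   [q] are form degrees. *)
Definition lambda1 (a : dform) : dform := ext_d a.

Definition lambda2 (Z : mvfield) (p : nat) (a b : dform) : dform := fun x s =>
  - (lie_der 2 Z (wedgef a b) x s - wedgef (lie_der 2 Z a) b x s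
     - (-1) ^+ p * wedgef a (lie_der 2 Z b) x s).

Definition lambda3 (Z : mvfield) (q : nat) (a b c : dform) : dform := fun x s =>
  (-1) ^+ q.+1 *
  sharp3 (a x) (b x) (c x) (fun xis => 2^-1 * schouten 2 Z 2 Z x xis) s.

Definition maurer_cartan (Z : mvfield) (b : dform) : Prop := forall x s,
  lambda1 b x s + 2^-1 * lambda2 Z 2 b b x s + 6^-1 * lambda3 Z 2 b b b x s = 0.

Definition closed_form (w : dform) : Prop := forall x s, ext_d w x s = 0.

Definition F_form (Z : mvfield) (b : dform) : dform :=
  fun x => F_fiber (Z x) (b x).

(* Openness of a subset [U] of the total space of wedge^2 T^*M, tested in the
   trivializations [crng i] x {skew matrices} given by the charts. *)
Definition wedge2_open (U : forall x : M, set (covec R n)) : Prop :=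
  forall i : chart M,
  let in_U (y : 'rV[R]_n) (B : 'M[R]_n) :=
    U (cparam i y) (fun s =>
      covec_of_mx B [seq v *m jac_at (cparam i y) i | v <- s]) in
  forall y B, crng i y -> B^T = - B -> in_U y B ->
  \forall y' \near y & B' \near B, crng i y' -> B'^T = - B' -> in_U y' B'.

End Manifold.

(* Main.v *)
From Pilot Require Import Defs.
From mathcomp Require Import all_boot all_order all_fingroup all_algebra.
From mathcomp Require Import all_classical all_reals all_analysis.
From mathcomp Require Import ring.
Import Order.TTheory GRing.Theory Num.Theory.
Import numFieldNormedType.Exports.
Import Pilot.Defs.
Set Implicit Arguments.
Unset Strict Implicit.
Unset Printing Implicit Defensive.
Local Open Scope classical_set_scope.
Local Open Scope ring_scope.

(** In a chart, write B and Z for the skew matrices of the 2-form and of the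
    bivector field, vectors being rows.  Then id + Z^# b^# is right
    multiplication by A = 1 + BZ, and the matrix of F(b) is P = A^-1 B.  The
    transpose of A is 1 + ZB, and P A^T = B.  Differentiating A P = B and
    multiplying by A^T on the right gives
      A (D_k P) A^T = D_k B - B (D_k Z) B.
    Consequently, for all vectors u, v, w at a point,
      d(F(b))(uA, vA, wA)
        = sum over the cyclic permutations of (u, v, w) of
          v (D_(uA) B - B (D_(uA) Z) B) w^T.                              (1)

    The right-hand side is the Maurer-Cartan expression evaluated at
    (u, v, w).  Indeed uA = u + uBZ, and the derivative is linear in its
    direction, so that (1) splits according to the degree in B.
    - Degree 1: the cyclic sum of v (D_u B) w^T is db.
    - Degree 2: the cyclic sum of v (D_(uBZ) B) w^T - v B (D_u Z) B w^T is
      half the Koszul bracket of b with itself; this is a Leibniz computation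
      inside the contraction with Z ([koszul_identity], [lambda2_iota_form]).
    - Degree 3: the cyclic sum of - v B (D_(uBZ) Z) B w^T is [Z, Z]/2 evaluated
      on the covectors i_u b, i_v b, i_w b, because [Z, Z]/2 is the cyclic sum
      of (D_(Z^# a1) Z)(a2, a3) ([half_schoutenE], [lambda3_iota_form]).

    Hence d(F(b))(uA, vA, wA) = MC(b)(u, v, w) identically ([ext_d_F]).  As A
    is invertible exactly over I_Z, the two 3-forms vanish together, and U can
    be taken to be the whole of I_Z; it is open because it is the locus where
    det(1 + BZ) does not vanish ([I_fiber_open]).

    All operators of the statement act in the chart selected at the point, while
    forms are stored in a different frame at each point.  Exterior product,
    insertion of a bivector and F are natural under a change of frame, so that
    they can be computed on local expressions before differentiating. *)

(** * Shuffles and recursion for the exterior product *)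

(** Putting the first position into the second block creates one inversion for
    each position of the first block, hence the sign in [ext_wedge_cons]. *)
Lemma mask_inversions_cons (k : nat) (c : bool) (m : k.-tuple bool) :
  mask_inversions [tuple of c :: m]
  = (mask_inversions m + (if c then 0 else count id m))%N.
Proof.
have E j (t : j.-tuple bool) : mask_inversions t
  = (\sum_(p < j) \sum_(q < j) [&& (p < q)%N, ~~ tnth t p & tnth t q])%N.
  rewrite /mask_inversions -sum1_card big_mkcond /= pair_big /=.
  by apply: eq_bigr => -[p q] _ /=; rewrite unfold_in /=; case: ifP.
rewrite !E big_ord_recl /= addnC; congr (_ + _)%N.
  apply: eq_bigr => p _; rewrite big_ord_recl /= add0n.
  by apply: eq_bigr => q _; rewrite !tnthS.
rewrite big_ord_recl ltnn /= add0n.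
rewrite (eq_bigr (fun q : 'I_k => (~~ c && tnth m q : nat))); last first.
  by move=> q _; rewrite tnthS tnth0.
case: c => /=; first by rewrite big1.
rewrite -sum1_count /= big_tuple [RHS]big_mkcond.
by apply: eq_bigr => q _; case: (tnth m q).
Qed.

Section Wedge.
Variables (R : realType) (n : nat).
Implicit Types (a b : covec R n) (s : seq 'rV[R]_n).

Lemma ext_wedge_nil a b : ext_wedge a b [::] = a [::] * b [::].
Proof.
rewrite /ext_wedge (big_pred1 [tuple]) => [|m]; last first.
  by rewrite [m]tuple0 /= eqxx.
rewrite (_ : mask_inversions _ = 0%N) ?mul1r//.
by rewrite /mask_inversions; apply: eq_card0 => -[[]].
Qed.

(** The graded Leibniz rule for insertion of a vector into an exterior product.
    It replaces sums over shuffles by a structural recursion from which all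
    low-degree formulas follow. *)
Lemma ext_wedge_cons a b v s :
  ext_wedge a b (v :: s) =
  ext_wedge (insert v a) b s
  + ext_wedge (fun t => (-1) ^+ size t * a t) (insert v b) s.
Proof.
rewrite /ext_wedge /=.
pose f (p : bool * (size s).-tuple bool) : (size s).+1.-tuple bool :=
  [tuple of p.1 :: p.2].
have fbij : bijective f.
  exists (fun t => (thead t, [tuple of behead t])) => [[c m]|t].
    by rewrite /f /=; congr pair; apply: val_inj.
  by rewrite /f /= [RHS]tuple_eta; apply: val_inj.
rewrite (reindex f) /=; last exact: onW_bij.
rewrite -(pair_bigA _ (fun c m => (-1) ^+ mask_inversions (f (c, m)) *
  a (mask (c :: m) (v :: s)) * b (mask (~~ c :: map negb m) (v :: s)))) /=.
rewrite big_bool /=; congr (_ + _); apply: eq_bigr => m _.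
  by rewrite mask_inversions_cons addn0.
rewrite mask_inversions_cons exprD size_mask ?size_tuple// /insert.
ring.
Qed.

Lemma ext_wedge_size p q a b s :
  (forall t, size t != p -> a t = 0) -> (forall t, size t != q -> b t = 0) ->
  size s != (p + q)%N -> ext_wedge a b s = 0.
Proof.
move=> a0 b0 sN; rewrite /ext_wedge big1// => m _.
have [mp|/a0->] := eqVneq (size (mask m s)) p; last by rewrite mulr0 mul0r.
rewrite [b _]b0 ?mulr0//; apply: contra sN => /eqP <-.
rewrite -mp !size_mask ?size_map ?size_tuple// count_map.
by rewrite -{1}(size_tuple m) -(count_predC id m).
Qed.

End Wedge.

(** * Multilinear functions as matrices *)

Lemma alternating_map (R : realType) (V V' : lmodType R) (f : {linear V -> V'})
    k (b : seq V' -> R) :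
  alternating k b -> alternating k (b \o map f).
Proof.
case=> b0 bl ba; split=> [s sk|s1 s2 a u v|s1 s2 s3 u] /=.
- by rewrite b0// size_map.
- by rewrite !map_cat /= linearP bl.
by rewrite !map_cat /= map_cat /= ba.
Qed.

Lemma unitmx_conj (R : realType) n (A J K : 'M[R]_n) : J *m K = 1%:M ->
  (J *m A *m K \in unitmx) = (A \in unitmx).
Proof. by move=> /mulmx1_unit[Ju Ku]; rewrite !unitmx_mul Ju Ku andbT. Qed.

Section Multilinear.
Variable R : realType.

(** Linearity as a bare predicate, in the shape in which [alternating] provides
    it for each argument. *)
Definition lin_form (V : lmodType R) (f : V -> R) :=
  forall a u v, f (a *: u + v) = a * f u + f v.

Lemma lin_form0 (V : lmodType R) (f : V -> R) : lin_form f -> f 0 = 0.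
Proof.
move=> fl; have := fl 1 0 0; rewrite scaler0 addr0 mul1r -{1}[f 0]addr0.
by move/addrI.
Qed.

Lemma lin_formN (V : lmodType R) (f : V -> R) u :
  lin_form f -> f (- u) = - f u.
Proof.
by move=> fl; rewrite -scaleN1r -[_ *: _]addr0 fl lin_form0 // addr0 mulN1r.
Qed.

Lemma lin_formD (V : lmodType R) (f : V -> R) u v :
  lin_form f -> f (u + v) = f u + f v.
Proof. by move=> /(_ 1 u v); rewrite scale1r mul1r. Qed.

Lemma lin_form_sum (V : lmodType R) (f : V -> R) (I : finType) (c : I -> R)
    (e : I -> V) :
  lin_form f -> f (\sum_i c i *: e i) = \sum_i c i * f (e i).
Proof.
move=> fl; elim/big_ind2: _ => [|x a y b <- <-|i _]; first exact: lin_form0.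
  exact: lin_formD.
by rewrite -[_ *: _]addr0 fl lin_form0 ?addr0.
Qed.

Lemma lin_form_add (V : lmodType R) (f g : V -> R) :
  lin_form f -> lin_form g -> lin_form (fun u => f u + g u).
Proof. by move=> fl gl a u v; rewrite fl gl; ring. Qed.

Variable n : nat.

Lemma rowE_sum (v : 'rV[R]_n) : v = \sum_i v 0 i *: ebasis R i.
Proof. exact: row_sum_delta. Qed.

Lemma colE_sum (xi : 'cV[R]_n) : xi = \sum_i xi i 0 *: dbasis R i.
Proof.
apply: trmx_inj; rewrite [LHS]row_sum_delta linear_sum /=.
by apply: eq_bigr => i _; rewrite linearZ /= trmx_delta mxE.
Qed.

Lemma mx_pair (v w : 'rV[R]_n) (B : 'M[R]_n) :
  (v *m B *m w^T) 0 0 = \sum_i \sum_j v 0 i * B i j * w 0 j.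
Proof.
rewrite mxE exchange_big /=; apply: eq_bigr => j _.
by rewrite !mxE mulr_suml.
Qed.

Lemma mx_pair_tr (v w : 'rV[R]_n) (B : 'M[R]_n) :
  (v *m B *m w^T) 0 0 = (w *m B^T *m v^T) 0 0.
Proof.
by rewrite -[LHS]trace_mx11 -mxtrace_tr trace_mx11 !trmx_mul trmxK mulmxA.
Qed.

Definition form_mx (b : covec R n) : 'M[R]_n :=
  \matrix_(i, j) b [:: ebasis R i; ebasis R j].
Definition mvec_mx (z : mvec R n) : 'M[R]_n :=
  \matrix_(i, j) z [:: dbasis R i; dbasis R j].

Lemma bilinE (f : 'rV[R]_n -> 'rV[R]_n -> R) (v w : 'rV[R]_n) :
  (forall w, lin_form (f^~ w)) -> (forall v, lin_form (f v)) ->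
  f v w = (v *m (\matrix_(i, j) f (ebasis R i) (ebasis R j)) *m w^T) 0 0.
Proof.
move=> fl fr; rewrite mx_pair {1}(rowE_sum v).
rewrite (lin_form_sum _ _ (fl w)); apply: eq_bigr => i _.
rewrite {1}(rowE_sum w) (lin_form_sum _ _ (fr _)) mulr_sumr.
by apply: eq_bigr => j _; rewrite mxE; ring.
Qed.

Section Alternating.
Variables (V : lmodType R) (b : seq V -> R).
Hypothesis b2 : alternating 2 b.

Lemma alt2_size s : size s != 2%N -> b s = 0.
Proof. by case: b2 => + _ _; apply. Qed.

Lemma alt2_linl w : lin_form (fun v => b [:: v; w]).
Proof. by move=> a u v; case: b2 => _ lin _; exact: (lin [::] [:: w]). Qed.

Lemma alt2_linr v : lin_form (fun w => b [:: v; w]).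
Proof. by move=> a u w; case: b2 => _ lin _; exact: (lin [:: v] [::]). Qed.

Lemma alt2_swap u v : b [:: u; v] = - b [:: v; u].
Proof.
have alt x : b [:: x; x] = 0 by case: b2 => _ _ a0; exact: (a0 [::] [::] [::]).
have := alt (1 *: u + v); rewrite (alt2_linl _ 1 u v) !(alt2_linr _ 1 u v).
rewrite !alt !mul1r addr0 add0r.
by move/eqP; rewrite addr_eq0 => /eqP.
Qed.

End Alternating.

Lemma alt2_mxE (b : covec R n) v w : alternating 2 b ->
  b [:: v; w] = (v *m form_mx b *m w^T) 0 0.
Proof.
move=> b2; apply: (@bilinE (fun v w => b [:: v; w])).
  exact: alt2_linl. exact: alt2_linr.
Qed.

Lemma alt2_mvecE (z : mvec R n) xi eta : alternating 2 z ->
  z [:: xi; eta] = (xi^T *m mvec_mx z *m eta) 0 0.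
Proof.
move=> z2; pose f (v w : 'rV[R]_n) := z [:: v^T; w^T].
rewrite (_ : z _ = f xi^T eta^T); last by rewrite /f !trmxK.
rewrite (@bilinE f) ?trmxK.
- congr ((_ *m _ *m _) 0 0).
  by apply/matrixP => i j; rewrite !mxE /f !trmx_delta.
- by move=> w a u v; rewrite /f linearP (alt2_linl z2).
by move=> v a u w; rewrite /f linearP (alt2_linr z2).
Qed.

Lemma form_mx_tr (b : covec R n) : alternating 2 b -> (form_mx b)^T = - form_mx b.
Proof. by move=> b2; apply/matrixP => i j; rewrite !mxE (alt2_swap b2). Qed.

Lemma mvec_mx_tr (z : mvec R n) : alternating 2 z -> (mvec_mx z)^T = - mvec_mx z.
Proof. by move=> b2; apply/matrixP => i j; rewrite !mxE (alt2_swap b2). Qed.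

Lemma flat2E (b : covec R n) v : alternating 2 b -> flat2 b v = (v *m form_mx b)^T.
Proof.
move=> b2; apply/matrixP => i j; rewrite !mxE alt2_mxE// trmx_delta.
by rewrite -colE !mxE; apply: eq_bigr => k _; rewrite !mxE !ord1.
Qed.

Lemma sharp2E (z : mvec R n) xi : alternating 2 z -> sharp2 z xi = xi^T *m mvec_mx z.
Proof.
move=> z2; apply/matrixP => i j; rewrite !mxE alt2_mvecE//.
by rewrite -colE !mxE !ord1.
Qed.

Lemma id_plusE (z : mvec R n) (b : covec R n) : alternating 2 z -> alternating 2 b ->
  id_plus z b = 1%:M + form_mx b *m mvec_mx z.
Proof.
move=> z2 b2; apply/row_matrixP => i; apply/rowP => j.
rewrite ![row _ _ _ _]mxE /= [LHS]mxE [RHS]mxE sharp2E// flat2E// trmxK.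
by rewrite -mulmxA -rowE !mxE eq_sym.
Qed.

Lemma F_fiberE (z : mvec R n) (b : covec R n) v w :
  alternating 2 z -> alternating 2 b ->
  F_fiber z b [:: v; w] =
  (v *m (invmx (1%:M + form_mx b *m mvec_mx z) *m form_mx b) *m w^T) 0 0.
Proof.
move=> z2 b2; rewrite /F_fiber flat2E// id_plusE// !mulmxA.
move: (v *m _ *m _) => u.
by rewrite -[RHS]trace_mx11 -mxtrace_tr trace_mx11 trmx_mul trmxK.
Qed.

Lemma big_tuple_cons (T : finType) k (F : k.+1.-tuple T -> R) :
  \sum_(I : k.+1.-tuple T) F I = \sum_i \sum_(I : k.-tuple T) F [tuple of i :: I].
Proof.
pose f (p : T * k.-tuple T) : k.+1.-tuple T := [tuple of p.1 :: p.2].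
rewrite (reindex f) /=; last first.
  exists (fun t => (thead t, [tuple of behead t])) => [[c m] _|t _].
    by rewrite /f /=; congr pair; apply: val_inj.
  by rewrite /f /= [RHS]tuple_eta; apply: val_inj.
by rewrite (pair_bigA _ (fun i I => F (f (i, I)))).
Qed.

Lemma big_tuple_nil (T : finType) (F : 0.-tuple T -> R) :
  \sum_(I : 0.-tuple T) F I = F [tuple].
Proof. by rewrite (big_pred1 [tuple]) => [//|m]; rewrite [m]tuple0 /= eqxx. Qed.

Lemma insertk2E (z : mvec R n) (w : covec R n) s :
  insertk 2 z w s = 2^-1 * \sum_i \sum_j
    z [:: dbasis R i; dbasis R j] * w [:: ebasis R j, ebasis R i & s].
Proof.
rewrite /insertk (_ : 2`! = 2%N)//; congr (_ * _).
rewrite big_tuple_cons; apply: eq_bigr => i _.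
rewrite big_tuple_cons; apply: eq_bigr => j _.
by rewrite big_tuple_nil.
Qed.

Section WedgeEval.
Variables a b : covec R n.

Lemma ext_wedge11 u v : (forall s, size s != 1%N -> a s = 0) ->
  (forall s, size s != 1%N -> b s = 0) ->
  ext_wedge a b [:: u; v] = a [:: u] * b [:: v] - a [:: v] * b [:: u].
Proof.
move=> a1 b1; rewrite !(ext_wedge_cons, ext_wedge_nil) /insert /=.
rewrite (a1 [::])// (a1 [:: u; v])//; ring.
Qed.

Lemma ext_wedge12 u v w : (forall s, size s != 1%N -> a s = 0) ->
  (forall s, size s != 2%N -> b s = 0) ->
  ext_wedge a b [:: u; v; w] =
  a [:: u] * b [:: v; w] - a [:: v] * b [:: u; w] + a [:: w] * b [:: u; v].
Proof.
move=> a1 b1; rewrite !(ext_wedge_cons, ext_wedge_nil) /insert /=.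
rewrite (a1 [::])// (a1 [:: u; v; w])// (a1 [:: u; v])// (a1 [:: u; w])//.
rewrite (a1 [:: v; w])//; ring.
Qed.

Lemma ext_wedge21 u v w : (forall s, size s != 2%N -> a s = 0) ->
  (forall s, size s != 1%N -> b s = 0) ->
  ext_wedge a b [:: u; v; w] =
  a [:: u; v] * b [:: w] - a [:: u; w] * b [:: v] + a [:: v; w] * b [:: u].
Proof.
move=> a1 b1; rewrite !(ext_wedge_cons, ext_wedge_nil) /insert /=.
rewrite (a1 [::])// (a1 [:: u; v; w])// (a1 [:: u])// (a1 [:: v])//.
rewrite (a1 [:: w])//; ring.
Qed.

(** For a = b this is twice the Pfaffian of the values of b on the four vectors. *)
Lemma ext_wedge22 u v w t : (forall s, size s != 2%N -> a s = 0) ->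
  (forall s, size s != 2%N -> b s = 0) ->
  ext_wedge a b [:: u; v; w; t] =
  a [:: u; v] * b [:: w; t] - a [:: u; w] * b [:: v; t] + a [:: u; t] * b [:: v; w]
  + a [:: v; w] * b [:: u; t] - a [:: v; t] * b [:: u; w] + a [:: w; t] * b [:: u; v].
Proof.
move=> a1 b1; rewrite !(ext_wedge_cons, ext_wedge_nil) /insert /=.
rewrite (a1 [::])// (a1 [:: u; v; w; t])// (a1 [:: u])// (a1 [:: v])//.
rewrite (a1 [:: w])// (a1 [:: t])// (a1 [:: u; v; w])// (a1 [:: u; v; t])//.
rewrite (a1 [:: u; w; t])// (a1 [:: v; w; t])//; ring.
Qed.

End WedgeEval.

Definition det3 (f g h : 'rV[R]_n -> R) u v w : R :=
  f u * (g v * h w - g w * h v) - f v * (g u * h w - g w * h u)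
  + f w * (g u * h v - g v * h u).

Lemma ext_wedge111 (a b c : covec R n) u v w :
  (forall s, size s != 1%N -> a s = 0) -> (forall s, size s != 1%N -> b s = 0) ->
  (forall s, size s != 1%N -> c s = 0) ->
  ext_wedge a (ext_wedge b c) [:: u; v; w] =
  det3 (fun x => a [:: x]) (fun x => b [:: x]) (fun x => c [:: x]) u v w.
Proof.
move=> a1 b1 c1; rewrite ext_wedge12// ?ext_wedge11// => s s2.
exact: (@ext_wedge_size _ _ 1 1).
Qed.

Lemma ext_wedge_map (f : 'rV[R]_n -> 'rV[R]_n) (a b : covec R n) s :
  ext_wedge a b (map f s) = ext_wedge (a \o map f) (b \o map f) s.
Proof.
elim: s a b => [|v s IH] a b; first by rewrite !ext_wedge_nil.
rewrite /= !ext_wedge_cons !IH; congr (_ + ext_wedge _ _ _).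
by apply/funext => t /=; rewrite size_map.
Qed.

(** Linearity in the first two arguments, which is all that the insertion of a
    bivector needs in order to be natural. *)
Definition bilin2 (w : covec R n) := forall s,
  (forall v, lin_form (fun u => w [:: u, v & s])) /\
  (forall u, lin_form (fun v => w [:: u, v & s])).

Lemma alternating_bilin2 k (w : covec R n) : alternating k w -> bilin2 w.
Proof.
case=> _ lin _ s; split=> v a u u'; first exact: (lin [::]).
exact: (lin [:: v]).
Qed.

Lemma ext_wedge22_bilin2 (a b : covec R n) :
  alternating 2 a -> alternating 2 b -> bilin2 (ext_wedge a b).
Proof.
move=> a2 b2; have a0 := alt2_size a2; have b0 := alt2_size b2.
have al w k u v := alt2_linl a2 w k u v.
have bl w k u v := alt2_linl b2 w k u v.
have ar w k u v := alt2_linr a2 w k u v.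
have br w k u v := alt2_linr b2 w k u v.
move=> s; case: (eqVneq (size s) 2%N) => [|s2]; last first.
  by split=> v k u u'; rewrite !(@ext_wedge_size _ _ 2 2)//= ?mulr0 ?addr0.
case: s => [|p [|q []]] // _; split=> v k u u'; rewrite !ext_wedge22//.
  by rewrite !(al, bl); ring.
by rewrite !(al, bl, ar, br); ring.
Qed.

Lemma bilin2_map (w : covec R n) (f : {linear 'rV[R]_n -> 'rV[R]_n}) :
  bilin2 w -> bilin2 (w \o map f).
Proof.
move=> w2 s; have [wl wr] := w2 (map f s).
split=> v k u u' /=; rewrite linearP; first exact: (wl (f v)).
exact: (wr (f v)).
Qed.

(** The insertion is the trace of the product of two matrices, which is
    unchanged when one is transformed by K and the other by its inverse. *)
Lemma insertk2_map (z : mvec R n) (w : covec R n) (J K : 'M[R]_n) s :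
  alternating 2 z -> bilin2 w -> K *m J = 1%:M ->
  insertk 2 (z \o map (mulmx K)) (w \o map (mulmxr J)) s =
  insertk 2 z w (map (mulmxr J) s).
Proof.
move=> z2 w2 KJ; rewrite !insertk2E; congr (_ * _) => /=.
pose G := \matrix_(i, j) w [:: ebasis R i, ebasis R j & map (mulmxr J) s].
have wE u v : w [:: u, v & map (mulmxr J) s] = (u *m G *m v^T) 0 0.
  have [wl wr] := w2 (map (mulmxr J) s).
  exact: (@bilinE (fun u v => w [:: u, v & map (mulmxr J) s])).
transitivity (\tr (K^T *m mvec_mx z *m K *m (J *m G *m J^T))).
  apply: eq_bigr => i _; rewrite mxE; apply: eq_bigr => j _.
  rewrite alt2_mvecE// wE !trmx_mul trmx_delta; congr (_ * _).
    by rewrite !mulmxA -colE mxE -!mulmxA -rowE [LHS]mxE.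
  rewrite trmx_delta.
  by rewrite !mulmxA -colE mxE -!mulmxA -rowE [LHS]mxE.
transitivity (\tr (mvec_mx z *m G)).
  rewrite -!mulmxA (mulmxA K) KJ mul1mx mxtrace_mulC -!mulmxA -trmx_mul KJ.
  by rewrite trmx1 mulmx1.
apply: eq_bigr => i _; rewrite mxE; apply: eq_bigr => j _; by rewrite !mxE.
Qed.

End Multilinear.

(** * Derivatives of matrix-valued functions *)

Section MatrixCalculus.
Variables (R : realType) (V : normedModType R) (y : V).

Lemma differentiable_bigsum (I : Type) (r : seq I) (P : pred I) (F : I -> V -> R) :
  (forall i, differentiable (F i) y) ->
  differentiable (fun y => \sum_(i <- r | P i) F i y) y.
Proof.
move=> dF; elim: r => [|i r IH].
  by under eq_fun do rewrite big_nil; exact: differentiable_cst.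
under eq_fun do rewrite big_cons; case: (P i) => //.
exact: (differentiableD (dF i) IH).
Qed.

Lemma differentiable_bigprod (I : Type) (r : seq I) (P : pred I) (F : I -> V -> R) :
  (forall i, differentiable (F i) y) ->
  differentiable (fun y => \prod_(i <- r | P i) F i y) y.
Proof.
move=> dF; elim: r => [|i r IH].
  by under eq_fun do rewrite big_nil; exact: differentiable_cst.
under eq_fun do rewrite big_cons; case: (P i) => //.
exact: (differentiableM (dF i) IH).
Qed.

(** Differentiability, rather than derivability in a given direction, because the
    derivative has to be linear in its direction. *)
Definition mx_differentiable m k (f : V -> 'M[R]_(m, k)) :=
  forall i j, differentiable (fun y => f y i j) y.

Lemma mx_differentiable_cst m k (A : 'M[R]_(m, k)) : mx_differentiable (fun=> A).
Proof. by move=> i j; exact: differentiable_cst. Qed.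

Lemma mx_differentiableD m k (f g : V -> 'M[R]_(m, k)) :
  mx_differentiable f -> mx_differentiable g ->
  mx_differentiable (fun y => f y + g y).
Proof.
move=> df dg i j; under eq_fun do rewrite mxE.
exact: (differentiableD (df i j) (dg i j)).
Qed.

Lemma mx_differentiableM m k l (f : V -> 'M[R]_(m, k)) (g : V -> 'M[R]_(k, l)) :
  mx_differentiable f -> mx_differentiable g ->
  mx_differentiable (fun y => f y *m g y).
Proof.
move=> df dg i j; under eq_fun do rewrite mxE.
by apply: differentiable_bigsum => h; exact: (differentiableM (df i h) (dg h j)).
Qed.

Lemma differentiable_det k (f : V -> 'M[R]_k) :
  mx_differentiable f -> differentiable (fun y => \det (f y)) y.
Proof.
move=> df; apply: differentiable_bigsum => s.
apply: (@differentiableM _ _ (cst ((-1) ^+ s)) (fun y => \prod_i f y i (s i))).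
  exact: differentiable_cst.
by apply: differentiable_bigprod.
Qed.

Lemma mx_differentiable_adj k (f : V -> 'M[R]_k) :
  mx_differentiable f -> mx_differentiable (fun y => \adj (f y)).
Proof.
move=> df i j; under eq_fun do rewrite mxE.
apply: (@differentiableM _ _ (cst ((-1) ^+ (j + i)))
  (fun y => \det (row' j (col' i (f y))))); first exact: differentiable_cst.
apply: differentiable_det => i' j'; under eq_fun do rewrite !mxE; exact: df.
Qed.

Lemma mx_derivable m k (f : V -> 'M[R]_(m, k)) u :
  mx_differentiable f -> derivable f y u.
Proof. by move=> df; apply/derivable_mxP => i j; exact/diff_derivable. Qed.

Lemma mx_deriveE m k (f : V -> 'M[R]_(m, k)) u i j :
  mx_differentiable f -> ('D_u f y) i j = 'D_u (fun y => f y i j) y.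
Proof. by move=> df; rewrite derive_mx ?mxE//; exact: mx_derivable. Qed.

Lemma derive_bigsum (I : finType) (F : I -> V -> R) u :
  (forall i, differentiable (F i) y) ->
  'D_u (fun y => \sum_i F i y) y = \sum_i 'D_u (F i) y.
Proof.
move=> dF; elim: (index_enum I) => [|i r IH].
  by rewrite big_nil; under eq_fun do rewrite big_nil; exact: derive_cst.
rewrite big_cons -IH; under eq_fun do rewrite big_cons.
exact: (deriveD (diff_derivable (dF i))
  (diff_derivable (differentiable_bigsum r xpredT dF))).
Qed.

Lemma mx_deriveD m k (f g : V -> 'M[R]_(m, k)) u :
  mx_differentiable f -> mx_differentiable g ->
  'D_u (fun y => f y + g y) y = 'D_u f y + 'D_u g y.
Proof. by move=> df dg; rewrite deriveD//; exact: mx_derivable. Qed.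

Lemma mx_deriveM m k l (f : V -> 'M[R]_(m, k)) (g : V -> 'M[R]_(k, l)) u :
  mx_differentiable f -> mx_differentiable g ->
  'D_u (fun y => f y *m g y) y = 'D_u f y *m g y + f y *m 'D_u g y.
Proof.
move=> df dg; apply/matrixP => i j.
rewrite mx_deriveE; last exact: mx_differentiableM.
under eq_fun do rewrite mxE.
rewrite derive_bigsum => [|h]; last exact: (differentiableM (df i h) (dg h j)).
rewrite !mxE -big_split /=; apply: eq_bigr => h _.
have -> := @deriveM _ _ (fun y => f y i h) (fun y => g y h j) y u
  (diff_derivable (df i h)) (diff_derivable (dg h j)).
by rewrite !mx_deriveE// addrC; congr (_ + _); exact: mulrC.
Qed.

Lemma mx_derive_pair m k (f : V -> 'M[R]_(m, k)) v w u : mx_differentiable f ->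
  'D_u (fun y => (v *m f y *m w) (0 : 'I_1) (0 : 'I_1)) y = (v *m 'D_u f y *m w) 0 0.
Proof.
move=> df; have dc := mx_differentiable_cst.
have dvf : mx_differentiable (fun y => v *m f y) by exact: mx_differentiableM.
rewrite -(mx_deriveE _ (f := fun y => v *m f y *m w)); last exact: mx_differentiableM.
by rewrite !mx_deriveM// !derive_cst mulmx0 mul0mx add0r addr0.
Qed.

End MatrixCalculus.

Section Pfaffian.
Variables (R : realType) (V : normedModType R) (y : V) (f f' g g' h h' : V -> R).
Hypotheses (df : differentiable f y) (df' : differentiable f' y).
Hypotheses (dg : differentiable g y) (dg' : differentiable g' y).
Hypotheses (dh : differentiable h y) (dh' : differentiable h' y).

Let pf := (f * f' - g * g') + h * h'.

Let pf_diff : differentiable pf y.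
Proof.
apply: differentiableD; last exact: differentiableM.
by apply: differentiableB; exact: differentiableM.
Qed.

Lemma differentiable_pfaffian :
  differentiable (fun z => 2 * (f z * f' z - g z * g' z + h z * h' z)) y.
Proof. exact: (@differentiableM _ _ (cst 2) pf). Qed.

Lemma derive_pfaffian u :
  'D_u (fun z => 2 * (f z * f' z - g z * g' z + h z * h' z)) y =
  2 * ('D_u f y * f' y + f y * 'D_u f' y - ('D_u g y * g' y + g y * 'D_u g' y)
       + ('D_u h y * h' y + h y * 'D_u h' y)).
Proof.
have D (k : V -> R) : differentiable k y -> derivable k y u by exact: diff_derivable.
rewrite (@deriveMl _ _ pf 2); last exact: D.
have dM (k l : V -> R) : differentiable k y -> differentiable l y ->
    derivable (k * l) y u.
  by move=> dk dl; exact/D/differentiableM.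
congr (_ * _); rewrite deriveD; [|by apply: derivableB; exact: dM|exact: dM].
rewrite deriveB; [|exact: dM..].
rewrite !deriveM; try exact: D.
rewrite /GRing.scale /=; move: ('D_u f y) ('D_u f' y) ('D_u g y) ('D_u g' y).
move: ('D_u h y) ('D_u h' y) (f y) (f' y) (g y) (g' y) (h y) (h' y) => *.
ring.
Qed.

End Pfaffian.

Section Inverse.
Variables (R : realType) (n : nat) (V : normedModType R) (y : V).
Variables (B Z : V -> 'M[R]_n).
Hypotheses (dB : mx_differentiable y B) (dZ : mx_differentiable y Z).
Let A z := 1%:M + B z *m Z z.
Hypothesis Au : \near y, A y \in unitmx.

(** The key computation: A Psi = B for Psi = A^-1 B gives
    A (D Psi) = DB - (DA) Psi with DA = (DB) Z + B (DZ), and Psi (1 + ZB) = B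
    turns the right-hand side, multiplied by 1 + ZB, into DB - B (DZ) B. *)
Lemma derive_gauge u (p : 'rV[R]_n) (q : 'cV[R]_n) :
  'D_u (fun z => (p *m A y *m (invmx (A z) *m B z)
                  *m ((1%:M + Z y *m B y) *m q)) 0 0) y =
  (p *m ('D_u B y - B y *m 'D_u Z y *m B y) *m q) 0 0.
Proof.
have dBZ : mx_differentiable y (fun z => B z *m Z z) by exact: mx_differentiableM.
have dc := mx_differentiable_cst y (1%:M : 'M[R]_n).
have dA : mx_differentiable y A by exact: mx_differentiableD.
have Ayu := nbhs_singleton Au.
(* invmx is defined by cases; this agrees with it near y and is manifestly
   differentiable. *)
pose Psi z := ((\det (A z))^-1 *: \adj (A z)) *m B z.
have dPsi : mx_differentiable y Psi.
  apply: mx_differentiableM => // i j; under eq_fun do rewrite mxE.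
  apply: (@differentiableM _ _ (fun z => (\det (A z))^-1) (fun z => (\adj (A z)) i j)).
    apply: differentiableV; first exact: differentiable_det.
    by move: Ayu; rewrite unitmxE unitfE.
  exact: mx_differentiable_adj.
have invE z : A z \in unitmx -> invmx (A z) *m B z = Psi z.
  by move=> uA; rewrite /Psi /invmx uA.
transitivity ('D_u (fun z => (p *m A y *m Psi z *m ((1%:M + Z y *m B y) *m q)) 0 0) y).
  by apply: near_eq_derive; apply: filterS Au => z /invE ->.
rewrite mx_derive_pair// mulmxA; congr (fun_of_matrix (_ *m q) 0 0).
rewrite -!mulmxA; congr (p *m _); rewrite mulmxA.
have : 'D_u (fun z => A z *m Psi z) y = 'D_u B y.
  by apply: near_eq_derive; apply: filterS Au => z uA; rewrite -invE// mulKVmx.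
rewrite mx_deriveM// mx_deriveD// derive_cst add0r mx_deriveM//.
move=> /(canRL (addKr _)) ->.
have -> : Psi y = invmx (A y) *m B y by rewrite invE.
have E : invmx (A y) *m B y *m (1%:M + Z y *m B y) = B y.
  rewrite -mulmxA (_ : B y *m _ = A y *m B y) ?mulKmx//.
  by rewrite /A mulmxDl mulmxDr mul1mx mulmx1 mulmxA.
rewrite [LHS]mulmxDl [X in X + _]mulNmx -[X in - X + _]mulmxA E !(mulmxDl, mulmxDr).
by rewrite mulmx1 !mulmxA addrC -addrA opprD addNKr.
Qed.

End Inverse.

(** * Change of chart *)

Section ChangeOfChart.
Variables (R : realType) (n : nat) (M : smooth_manifold R n).
Local Notation chart_at := (@chart_at R n M).
Local Notation coord x := (ccoord (chart_at x) x).
Implicit Types (i j : chart M) (y : 'rV[R]_n) (w : dform M) (Y : mvfield M).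

Lemma near_crng i y : crng i y -> \near y, crng i y.
Proof. by move=> iy; apply: open_nbhs_nbhs; split=> //; exact: crng_open. Qed.

Lemma near_cdom i j y : crng i y -> cdom j (cparam i y) ->
  \near y, cdom j (cparam i y).
Proof.
move=> iy jy; apply: (param_continuous iy); apply: open_nbhs_nbhs.
by split=> //; exact: cdom_open.
Qed.

Lemma transition_differentiable i j y : crng i y -> cdom j (cparam i y) ->
  differentiable (ccoord j \o cparam i) y.
Proof. by move=> iy jy; case: (transition_smooth i j 1%N) => + _; apply. Qed.

(** Chain rule for the two mutually inverse transition maps. *)
Lemma jac_comp i j y : crng i y -> cdom j (cparam i y) ->
  jac i j y *m jac j i (ccoord j (cparam i y)) = 1%:M.
Proof.
move=> iy jy; set z := ccoord j _.
have dg := transition_differentiable iy jy.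
have dh : differentiable (ccoord i \o cparam j) z.
  apply: transition_differentiable; first exact: coord_crng.
  by rewrite coordK//; exact: param_cdom.
apply/row_matrixP => k; rewrite !rowE mulmx1 mulmxA !mul_rV_lin1 /=.
rewrite -[LHS]/(('d (ccoord i \o cparam j) z \o 'd (ccoord j \o cparam i) y) _).
rewrite -(diff_comp dg dh) -deriveE; last exact: differentiable_comp.
rewrite -[RHS](derive_id y); apply: near_eq_derive; near=> t => /=.
have ti : crng i t by near: t; exact: near_crng.
have tj : cdom j (cparam i t) by near: t; exact: near_cdom.
by rewrite coordK// paramK.
Unshelve. all: by end_near. Qed.

Lemma jac_id i y : crng i y -> jac i i y = 1%:M.
Proof.
move=> iy; have dg := transition_differentiable iy (param_cdom iy).
apply/row_matrixP => k; rewrite !rowE mulmx1 mul_rV_lin1 /= -deriveE//.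
rewrite -[RHS](derive_id y); apply: near_eq_derive.
by apply: filterS (near_crng iy) => t /= /paramK.
Qed.

(** The frame at a point is the one of the chart selected at that very point;
    this matrix converts components from the chart i to that frame. *)
Definition jac_to i y : 'M[R]_n := jac i (chart_at (cparam i y)) y.

Lemma jac_toK i y : crng i y -> jac_to i y *m jac_at (cparam i y) i = 1%:M.
Proof. by move=> iy; apply: jac_comp => //; exact: chart_atP. Qed.

Lemma jac_atK i y : crng i y -> jac_at (cparam i y) i *m jac_to i y = 1%:M.
Proof. by move=> /jac_toK /mulmx1C. Qed.

Lemma coord_crng_at (x : M) : crng (chart_at x) (coord x).
Proof. exact/coord_crng/chart_atP. Qed.

Lemma form_in_at w (x : M) : form_in (chart_at x) w (coord x) = w x.
Proof.
apply/funext => s; rewrite /form_in coordK; last exact: chart_atP.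
rewrite jac_id; last exact: coord_crng_at.
by rewrite (eq_map (@mulmx1 _ _ _)) map_id.
Qed.

Lemma mvfield_in_at Y (x : M) : mvfield_in (chart_at x) Y (coord x) = Y x.
Proof.
apply/funext => s; rewrite /mvfield_in coordK; last exact: chart_atP.
rewrite /jac_at jac_id; last exact: coord_crng_at.
by rewrite (eq_map (@mul1mx _ _ _)) map_id.
Qed.

Lemma form_in_alternating i w y k :
  alternating k (w (cparam i y)) -> alternating k (form_in i w y).
Proof. exact: (@alternating_map _ _ _ (mulmxr (jac_to i y))). Qed.

Lemma mvfield_in_alternating i Y y k :
  alternating k (Y (cparam i y)) -> alternating k (mvfield_in i Y y).
Proof. exact: (@alternating_map _ _ _ (mulmx (jac_at (cparam i y) i))). Qed.

Lemma form_in_wedge i (a b : dform M) y :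
  form_in i (wedgef a b) y = ext_wedge (form_in i a y) (form_in i b y).
Proof. by apply/funext => s; rewrite /form_in /wedgef ext_wedge_map. Qed.

(** Together with [form_in_wedge] and [form_in_F], this lets the derivative in
    [ext_d] act on expressions in the components of the local form. *)
Lemma form_in_iota i Y w y : alternating 2 (Y (cparam i y)) ->
  bilin2 (w (cparam i y)) -> crng i y ->
  form_in i (iotaf 2 Y w) y = insertk 2 (mvfield_in i Y y) (form_in i w y).
Proof.
move=> Y2 w2 iy; apply/funext => s; rewrite [RHS]insertk2_map//.
exact: jac_atK.
Qed.

Lemma form_in_const (x : M) (w : covec R n) y : crng (chart_at x) y ->
  form_in (chart_at x) (const_form x w) y = w.
Proof.
move=> iy; apply/funext => s; rewrite /form_in /const_form -map_comp.
rewrite -[RHS](congr1 w (map_id s)); congr w.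
by apply: eq_map => v /=; rewrite -mulmxA jac_toK// mulmx1.
Qed.

Lemma form_mx_in i w y : alternating 2 (w (cparam i y)) ->
  form_mx (form_in i w y) = jac_to i y *m form_mx (w (cparam i y)) *m (jac_to i y)^T.
Proof.
move=> w2; apply/matrixP => k l; rewrite [LHS]mxE /form_in /= alt2_mxE//.
by rewrite trmx_mul trmx_delta !mulmxA -colE mxE -!mulmxA -rowE [LHS]mxE.
Qed.

Lemma mvec_mx_in i Y y : alternating 2 (Y (cparam i y)) ->
  mvec_mx (mvfield_in i Y y) =
  (jac_at (cparam i y) i)^T *m mvec_mx (Y (cparam i y)) *m jac_at (cparam i y) i.
Proof.
move=> w2; apply/matrixP => k l; rewrite [LHS]mxE /mvfield_in /= alt2_mvecE//.
by rewrite trmx_mul trmx_delta !mulmxA -colE mxE -!mulmxA -rowE [LHS]mxE.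
Qed.

(** The endomorphism id + Z^# b^# is conjugated by a change of frame, so its
    invertibility does not depend on the chart. *)
Lemma gauge_mx_in i (Y : mvfield M) (b : dform M) y : crng i y ->
  alternating 2 (Y (cparam i y)) -> alternating 2 (b (cparam i y)) ->
  1%:M + form_mx (form_in i b y) *m mvec_mx (mvfield_in i Y y) =
  jac_to i y *m (1%:M + form_mx (b (cparam i y)) *m mvec_mx (Y (cparam i y)))
    *m jac_at (cparam i y) i.
Proof.
move=> iy Y2 b2; rewrite form_mx_in// mvec_mx_in//.
have KJT : (jac_to i y)^T *m (jac_at (cparam i y) i)^T = 1%:M.
  by rewrite -trmx_mul jac_atK// trmx1.
rewrite mulmxDr mulmxDl mulmx1 jac_toK//; congr (_ + _).
by rewrite !mulmxA -[X in X *m _ *m _]mulmxA KJT mulmx1.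
Qed.

Lemma form_in_F i (Y : mvfield M) (b : dform M) y (u v : 'rV[R]_n) : crng i y ->
  alternating 2 (Y (cparam i y)) -> alternating 2 (b (cparam i y)) ->
  I_fiber (Y (cparam i y)) (b (cparam i y)) ->
  form_in i (F_form Y b) y [:: u; v] =
  (u *m (invmx (1%:M + form_mx (form_in i b y) *m mvec_mx (mvfield_in i Y y))
     *m form_mx (form_in i b y)) *m v^T) 0 0.
Proof.
move=> iy Y2 b2 [_]; rewrite id_plusE// => Au.
rewrite gauge_mx_in// form_mx_in//.
rewrite /form_in -/(jac_to i y) /F_form F_fiberE//.
set A := _ + _ in Au *; set J := jac_to i y; set K := jac_at _ i.
have JK : J *m K = 1%:M by exact: jac_toK.
have KJ := mulmx1C JK.
move: A Au J K JK KJ => A Au J K JK KJ.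
suff -> : invmx (J *m A *m K) = J *m invmx A *m K.
  rewrite -!mulmxA (mulmxA K J) KJ mul1mx trmx_mul.
  by [].
have E : J *m A *m K *m (J *m invmx A *m K) = 1%:M.
  by rewrite -!mulmxA (mulmxA K J) KJ mul1mx (mulmxA A) mulmxV// mul1mx.
have [Lu _] := mulmx1_unit E.
by rewrite -[RHS](mulKmx Lu) E mulmx1.
Qed.

End ChangeOfChart.

(** * Contractions and form degrees *)

Section Contraction.
Variables (R : realType) (n : nat).
Implicit Types f g : 'I_n -> 'I_n -> R.

(** Contraction with a bivector in coordinates: the factor 1/2 compensates for
    each e_i /\ e_j being counted twice. *)
Definition half_sum f : R := 2^-1 * \sum_i \sum_j f i j.

Lemma half_sumD f g : half_sum f + half_sum g = half_sum (fun i j => f i j + g i j).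
Proof.
rewrite -mulrDr -big_split; congr (_ * _); apply: eq_bigr => i _.
by rewrite -big_split.
Qed.

Lemma half_sumMr f a : half_sum f * a = half_sum (fun i j => f i j * a).
Proof.
rewrite -mulrA mulr_suml; congr (_ * _); apply: eq_bigr => i _.
by rewrite mulr_suml.
Qed.

Lemma half_sumMl f a : a * half_sum f = half_sum (fun i j => a * f i j).
Proof.
rewrite mulrCA mulr_sumr; congr (_ * _); apply: eq_bigr => i _.
by rewrite mulr_sumr.
Qed.

Lemma half_sumN f : - half_sum f = half_sum (fun i j => - f i j).
Proof.
rewrite -mulN1r half_sumMl; congr half_sum; apply/funext => i; apply/funext => j.
by rewrite mulN1r.
Qed.

Lemma eq_half_sum f g : (forall i j, f i j = g i j) -> half_sum f = half_sum g.
Proof.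
by move=> fg; congr half_sum; apply/funext => i; apply/funext => j.
Qed.

(** Antisymmetrizing the second factor makes identities between contractions
    hold summand by summand. *)
Lemma skew_half_sum (z : 'M[R]_n) f : z^T = - z ->
  \sum_i \sum_j z i j * f i j = half_sum (fun i j => z i j * (f i j - f j i)).
Proof.
move=> /matrixP zT.
rewrite /half_sum; set S := LHS.
suff -> : \sum_i \sum_j z i j * (f i j - f j i) = S + S by field.
transitivity (S + \sum_j \sum_i z i j * f i j); last by rewrite exchange_big.
rewrite /S -big_split; apply: eq_bigr => i _ /=.
rewrite -big_split; apply: eq_bigr => j _ /=.
by have := zT i j; rewrite !mxE => ->; ring.
Qed.

Lemma derive_half_sum (V : normedModType R) (f g : 'I_n -> 'I_n -> V -> R) y u :
  (forall i j, differentiable (f i j) y) -> (forall i j, differentiable (g i j) y) ->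
  'D_u (fun z => half_sum (fun i j => f i j z * g i j z)) y =
  half_sum (fun i j => 'D_u (f i j) y * g i j y + f i j y * 'D_u (g i j) y).
Proof.
move=> df dg; rewrite /half_sum.
have dfg i j : differentiable (fun z => f i j z * g i j z) y.
  exact: (differentiableM (df i j) (dg i j)).
have ds i : differentiable (fun z => \sum_j f i j z * g i j z) y.
  exact: differentiable_bigsum.
rewrite deriveMl; last exact/diff_derivable/differentiable_bigsum.
congr (_ * _); rewrite derive_bigsum//; apply: eq_bigr => i _.
rewrite derive_bigsum//; apply: eq_bigr => j _.
rewrite deriveM; [|exact/diff_derivable..].
by rewrite /GRing.scale /=; ring.
Qed.

End Contraction.

Section Degrees.
Variables (R : realType) (n : nat) (M : smooth_manifold R n).
Implicit Types (w : dform M) (Y : mvfield M).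

Definition of_degree k w := forall y s, size s != k -> w y s = 0.

Lemma alternating_degree k w : (forall y, alternating k (w y)) -> of_degree k w.
Proof. by move=> wk y s; case: (wk y) => + _ _; apply. Qed.

Lemma ext_d_degree k w : of_degree k w -> of_degree k.+1 (ext_d w).
Proof.
move=> wk x s sk; apply: big1 => j _.
rewrite (_ : (fun y => _) = cst 0) ?derive_cst ?mulr0//.
apply/funext => y; apply: wk; rewrite size_map size_cat size_take size_drop ltn_ord.
apply: contra sk => /eqP <-; rewrite -addnS -subSn ?ltn_ord// subSS.
by rewrite subnKC// ltnW.
Qed.

Lemma iota_degree k Y w : of_degree k.+2 w -> of_degree k (iotaf 2 Y w).
Proof.
move=> wk x s sk; rewrite /iotaf insertk2E big1 ?mulr0// => i _.
by rewrite big1// => j _; rewrite wk ?mulr0.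
Qed.

Lemma lie_degree k Y w : of_degree k.+2 w -> of_degree k.+1 (lie_der 2 Y w).
Proof.
move=> wk x s sk; rewrite /lie_der (iota_degree Y (ext_d_degree wk))//.
by rewrite (ext_d_degree (iota_degree Y wk))// mulr0 subr0.
Qed.

Lemma wedge_degree k l (a b : dform M) :
  of_degree k a -> of_degree l b -> of_degree (k + l) (wedgef a b).
Proof. by move=> ak bl y s; apply: ext_wedge_size => t; [exact: ak|exact: bl]. Qed.

Lemma lambda2_degree Y (a b : dform M) : of_degree 2 a -> of_degree 2 b ->
  of_degree 3 (lambda2 Y 2 a b).
Proof.
move=> a2 b2 x s s3; have la := lie_degree Y a2; have lb := lie_degree Y b2.
rewrite /lambda2 (lie_degree Y (k := 2))//; last exact: (wedge_degree a2 b2).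
rewrite (wedge_degree la b2)// (wedge_degree a2 lb)//.
by rewrite mulr0 !subr0 oppr0.
Qed.

Lemma lambda3_degree Y (a b c : dform M) :
  of_degree 2 a -> of_degree 2 b -> of_degree 2 c -> of_degree 3 (lambda3 Y 2 a b c).
Proof.
move=> a2 b2 c2 x s s3; rewrite /lambda3 /sharp3 big1 ?mulr0// => I _.
rewrite big1 ?mulr0// => sg _.
rewrite (@ext_wedge_size _ _ 1 2) ?mulr0// => t t1; first exact: a2.
by apply: (@ext_wedge_size _ _ 1 1) => // t' t'1; [exact: b2|exact: c2].
Qed.

Local Notation loc x w := (form_in (chart_at x) w).
Local Notation coord x := (ccoord (chart_at x) x).

Lemma ext_d1E w x p :
  ext_d w x [:: p] = 'D_p (fun y => loc x w y [::]) (coord x).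
Proof. by rewrite /ext_d big_ord_recl big_ord0 addr0 mul1r. Qed.

Lemma ext_d2E w x p q : ext_d w x [:: p; q] =
  'D_p (fun y => loc x w y [:: q]) (coord x)
  - 'D_q (fun y => loc x w y [:: p]) (coord x).
Proof. by rewrite /ext_d !big_ord_recl big_ord0 /= /bump /=; ring. Qed.

Lemma ext_d3E w x p q r : ext_d w x [:: p; q; r] =
  'D_p (fun y => loc x w y [:: q; r]) (coord x)
  - 'D_q (fun y => loc x w y [:: p; r]) (coord x)
  + 'D_r (fun y => loc x w y [:: p; q]) (coord x).
Proof. by rewrite /ext_d !big_ord_recl big_ord0 /= /bump /=; ring. Qed.

Lemma ext_d5E w x p q r s t : ext_d w x [:: p; q; r; s; t] =
  'D_p (fun y => loc x w y [:: q; r; s; t]) (coord x)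
  - 'D_q (fun y => loc x w y [:: p; r; s; t]) (coord x)
  + 'D_r (fun y => loc x w y [:: p; q; s; t]) (coord x)
  - 'D_s (fun y => loc x w y [:: p; q; r; t]) (coord x)
  + 'D_t (fun y => loc x w y [:: p; q; r; s]) (coord x).
Proof. by rewrite /ext_d !big_ord_recl big_ord0 /= /bump /=; ring. Qed.

End Degrees.

(** * The binary bracket of a 2-form with itself *)

(** The Koszul bracket of a 2-form f with itself, for a bivector z (p /\ q) whose
    coefficient has derivatives zu, zv, zw along u, v, w: W is f /\ f, DW its
    derivative and L the Lie derivative of f.  The surviving terms without a
    derivative of z pair one of p, q with an argument and differentiate along the
    other one; the terms containing f p q cancel. *)
Lemma koszul_identity (R : realType) (T : Type) (f : T -> T -> R)
    (D : T -> T -> T -> R) (z zu zv zw : R) p q u v w :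
  (forall a b, f a b = - f b a) -> (forall a b c, D a b c = - D a c b) ->
  let W a b c d := 2 * (f a b * f c d - f a c * f b d + f a d * f b c) in
  let DW k a b c d := 2 * (D k a b * f c d + f a b * D k c d
       - (D k a c * f b d + f a c * D k b d)
       + (D k a d * f b c + f a d * D k b c)) in
  let L zt t := z * (D q p t - D p q t) - zt * f q p in
  2^-1 * - (z * (DW q p u v w - DW p q u v w + DW u q p v w - DW v q p u w + DW w q p u v)
   - (zu * W q p v w + z * DW u q p v w) + (zv * W q p u w + z * DW v q p u w)
   - (zw * W q p u v + z * DW w q p u v)
   - 2 * (L zu u * f v w - L zv v * f u w + L zw w * f u v)) =
  z * (f u p * D q v w - f u q * D p v w + (f v p * D q w u - f v q * D p w u)
     + (f w p * D q u v - f w q * D p u v))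
  - zu * (f v p * f q w - f v q * f p w) - zv * (f w p * f q u - f w q * f p u)
  - zw * (f u p * f q v - f u q * f p v).
Proof.
move=> fs Ds W DW L; rewrite /L /DW /W.
rewrite (fs u p) (fs v p) (fs w p) (fs u q) (fs v q) (fs w q) (fs q p).
have := (fun k => Ds k u p, fun k => Ds k v p, fun k => Ds k w p,
  (fun k => Ds k u q, fun k => Ds k v q, fun k => Ds k w q,
   fun k => Ds k w u, fun k => Ds k q p)).
move=> {}Ds; rewrite !Ds.
by field.
Qed.

Lemma half_sum_koszul (R : realType) (n : nat) (f g h k l : 'I_n -> 'I_n -> R)
    (a b c : R) :
  (forall i j, 2^-1 * - (f i j - 2 * (g i j * a - h i j * b + k i j * c)) = l i j) ->
  2^-1 * - (half_sum f - 2 * (half_sum g * a - half_sum h * b + half_sum k * c))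
  = half_sum l.
Proof.
move=> E; rewrite !half_sumMr !(half_sumN, half_sumD) half_sumMl half_sumN half_sumD.
by rewrite half_sumN half_sumMl; exact: eq_half_sum.
Qed.

Section AtPoint.
Variables (R : realType) (n : nat) (M : smooth_manifold R n).
Variables (Z : mvfield M) (b : dform M).
Hypotheses (hZ : is_mvfield 2 Z) (hb : is_form 2 b).
Variable x : M.
Local Notation e := (ebasis R).
Local Notation i0 := (chart_at x).
Local Notation y0 := (ccoord (chart_at x) x).
Local Notation beta y p q := (form_in i0 b y [:: p; q]).
Local Notation zeta y i j := (mvfield_in i0 Z y [:: dbasis R i; dbasis R j]).
Local Notation bx p q := (b x [:: p; q]).
Local Notation zx i j := (Z x [:: dbasis R i; dbasis R j]).
Local Notation Db u p q := ('D_u (fun y => beta y p q) y0).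
Local Notation Dz u i j := ('D_u (fun y => zeta y i j) y0).

Let b2 y : alternating 2 (b y). Proof. by case: hb. Qed.
Let Z2 y : alternating 2 (Z y). Proof. by case: hZ. Qed.
Let y0_crng := coord_crng_at x.

Lemma beta_diff p q : differentiable (fun y => beta y p q) y0.
Proof. by case: hb => _ /(_ i0 [:: p; q] 1%N) [+ _]; apply. Qed.

Lemma zeta_diff i j : differentiable (fun y => zeta y i j) y0.
Proof.
by case: hZ => _ /(_ i0 [:: dbasis R i; dbasis R j] 1%N) [+ _]; apply.
Qed.

Lemma beta_swap y p q : beta y p q = - beta y q p.
Proof. exact/alt2_swap/form_in_alternating. Qed.

Lemma beta_at p q : beta y0 p q = bx p q.
Proof. by rewrite form_in_at. Qed.

Lemma zeta_at i j : zeta y0 i j = zx i j.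
Proof. by rewrite mvfield_in_at. Qed.

(** Skewness passes to the derivative because it holds at each point of the
    chart. *)
Lemma Db_swap u p q : Db u p q = - Db u q p.
Proof.
rewrite -deriveN; last exact/diff_derivable/beta_diff.
by congr ('D_u _ y0); apply/funext => y; exact: beta_swap.
Qed.

Lemma derive_iota_b u : 'D_u (fun y => form_in i0 (iotaf 2 Z b) y [::]) y0 =
  half_sum (fun i j => Dz u i j * bx (e j) (e i) + zx i j * Db u (e j) (e i)).
Proof.
transitivity ('D_u (fun y => half_sum (fun i j => zeta y i j * beta y (e j) (e i))) y0).
  apply: near_eq_derive; apply: filterS (near_crng y0_crng) => y iy.
  by rewrite form_in_iota ?insertk2E//; exact: alternating_bilin2.
rewrite derive_half_sum; [|exact: zeta_diff|by move=> i j; exact: beta_diff].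
by apply: eq_half_sum => i j; rewrite beta_at zeta_at.
Qed.

(** The derivative of b along q in i_Z db cancels against the one in d i_Z b. *)
Lemma lie_bE q : lie_der 2 Z b x [:: q] =
  half_sum (fun i j => zx i j * (Db (e j) (e i) q - Db (e i) (e j) q)
     - Dz q i j * bx (e j) (e i)).
Proof.
rewrite /lie_der ext_d1E derive_iota_b /iotaf insertk2E expr2 mulrNN !mul1r.
rewrite -[X in X - _]/(half_sum _) half_sumN half_sumD; apply: eq_half_sum => i j.
rewrite ext_d3E; ring.
Qed.

Local Notation gamma y p q r t := (form_in i0 (wedgef b b) y [:: p; q; r; t]).

Lemma gammaE y p q r t : gamma y p q r t =
  2 * (beta y p q * beta y r t - beta y p r * beta y q t + beta y p t * beta y q r).
Proof.
have bs := alt2_size (form_in_alternating (i := i0) (w := b) (y := y) (b2 _)).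
by rewrite form_in_wedge ext_wedge22//; ring.
Qed.

Lemma gamma_diff p q r t : differentiable (fun y => gamma y p q r t) y0.
Proof.
under eq_fun do rewrite gammaE.
by apply: differentiable_pfaffian; exact: beta_diff.
Qed.

Lemma derive_gamma u p q r t : 'D_u (fun y => gamma y p q r t) y0 =
  2 * (Db u p q * bx r t + bx p q * Db u r t
       - (Db u p r * bx q t + bx p r * Db u q t)
       + (Db u p t * bx q r + bx p t * Db u q r)).
Proof.
under eq_fun do rewrite gammaE.
by rewrite derive_pfaffian ?beta_at//; exact: beta_diff.
Qed.

Lemma derive_iota_bb u v w :
  'D_u (fun y => form_in i0 (iotaf 2 Z (wedgef b b)) y [:: v; w]) y0 =
  half_sum (fun i j => Dz u i j * gamma y0 (e j) (e i) v w
    + zx i j * 'D_u (fun y => gamma y (e j) (e i) v w) y0).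
Proof.
transitivity ('D_u (fun y =>
    half_sum (fun i j => zeta y i j * gamma y (e j) (e i) v w)) y0).
  apply: near_eq_derive; apply: filterS (near_crng y0_crng) => y iy.
  by rewrite form_in_iota ?insertk2E//; exact: ext_wedge22_bilin2.
rewrite derive_half_sum; [|exact: zeta_diff|by move=> i j; exact: gamma_diff].
by apply: eq_half_sum => i j; rewrite zeta_at.
Qed.

Lemma lie_bb3E u v w : lie_der 2 Z (wedgef b b) x [:: u; v; w] =
  half_sum (fun i j => zx i j * ext_d (wedgef b b) x [:: e j; e i; u; v; w]
   - (Dz u i j * gamma y0 (e j) (e i) v w
      + zx i j * 'D_u (fun y => gamma y (e j) (e i) v w) y0)
   + (Dz v i j * gamma y0 (e j) (e i) u w
      + zx i j * 'D_v (fun y => gamma y (e j) (e i) u w) y0)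
   - (Dz w i j * gamma y0 (e j) (e i) u v
      + zx i j * 'D_w (fun y => gamma y (e j) (e i) u v) y0)).
Proof.
rewrite /lie_der ext_d3E !derive_iota_bb /iotaf insertk2E expr2 mulrNN !mul1r.
rewrite -[X in X - _]/(half_sum _) !(half_sumN, half_sumD); apply: eq_half_sum => i j.
by rewrite !opprD !opprK !addrA.
Qed.

Lemma lambda2_raw u v w : 2^-1 * lambda2 Z 2 b b x [:: u; v; w] =
  2^-1 * - (lie_der 2 Z (wedgef b b) x [:: u; v; w]
   - 2 * (lie_der 2 Z b x [:: u] * bx v w - lie_der 2 Z b x [:: v] * bx u w
     + lie_der 2 Z b x [:: w] * bx u v)).
Proof.
have bd : of_degree 2 b by exact: alternating_degree.
have ld : of_degree 1 (lie_der 2 Z b) by exact: (@lie_degree _ _ _ 0).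
rewrite /lambda2 /wedgef ext_wedge12; [|exact: ld|exact: bd].
rewrite ext_wedge21; [|exact: bd|exact: ld].
move: (lie_der _ _ _ _ _) => L0; move: (lie_der _ _ _) => L.
move: (L x [:: u]) (L x [:: v]) (L x [:: w]) => L1 L2 L3.
move: (bx v w) (bx u w) (bx u v) => B1 B2 B3.
rewrite expr2; ring.
Qed.

(** The bracket in coordinates; [koszul_identity] applies summand by summand, with
    p = e_i and q = e_j. *)
Lemma lambda2E u v w : 2^-1 * lambda2 Z 2 b b x [:: u; v; w] =
  half_sum (fun i j =>
    zx i j * (bx u (e i) * Db (e j) v w - bx u (e j) * Db (e i) v w
            + (bx v (e i) * Db (e j) w u - bx v (e j) * Db (e i) w u)
            + (bx w (e i) * Db (e j) u v - bx w (e j) * Db (e i) u v))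
    - Dz u i j * (bx v (e i) * bx (e j) w - bx v (e j) * bx (e i) w)
    - Dz v i j * (bx w (e i) * bx (e j) u - bx w (e j) * bx (e i) u)
    - Dz w i j * (bx u (e i) * bx (e j) v - bx u (e j) * bx (e i) v)).
Proof.
rewrite lambda2_raw lie_bb3E !lie_bE.
apply: half_sum_koszul => i j; rewrite ext_d5E !derive_gamma !gammaE !beta_at.
have fs p q : bx p q = - bx q p by exact: alt2_swap.
exact: (@koszul_identity _ _ (fun p q => bx p q) (fun u p q => Db u p q) (zx i j)
  (Dz u i j) (Dz v i j) (Dz w i j) (e i) (e j) u v w fs Db_swap).
Qed.

End AtPoint.

(** * The action of a trivector on three 2-forms *)

Section Trivector.
Variables (R : realType) (n : nat).

(** The Leibniz formula for a 3 x 3 determinant.  Indexing by naturals lets the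
    entries of a concrete sequence be permuted. *)
Lemma sum_S3 (t : nat -> 'rV[R]_n -> R) p q r :
  \sum_(sg : 'S_3) (-1) ^+ sg *
    (t (sg (@Ordinal 3 0 isT)) p * t (sg (@Ordinal 3 1 isT)) q
     * t (sg (@Ordinal 3 2 isT)) r) =
  det3 (t 0%N) (t 1%N) (t 2%N) p q r.
Proof.
pose A := \matrix_(i < 3, j < 3) t j (nth p [:: p; q; r] i).
transitivity (\det A).
  apply: eq_bigr => sg _; congr (_ * _).
  rewrite !big_ord_recr big_ord0 /= mul1r !mxE /=.
  by congr (t (sg _) _ * t (sg _) _ * t (sg _) _); apply: val_inj.
rewrite (expand_det_row _ ord0) !big_ord_recl big_ord0 /cofactor.
rewrite !(expand_det_row _ ord0) !big_ord_recl !big_ord0 /cofactor !det_mx11.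
rewrite !mxE /= /bump /= /det3; ring.
Qed.

(** An alternating function antisymmetrized over its three arguments is
    multiplied by 6; each of the six terms of [det3] is again a determinant. *)
Lemma sum_S3_det3 (t : nat -> 'rV[R]_n -> R) u v w :
  \sum_(sg : 'S_3) (-1) ^+ sg *
    det3 (t (sg (@Ordinal 3 0 isT))) (t (sg (@Ordinal 3 1 isT)))
      (t (sg (@Ordinal 3 2 isT))) u v w =
  6 * det3 (t 0%N) (t 1%N) (t 2%N) u v w.
Proof.
pose D p q r := \sum_(sg : 'S_3) (-1) ^+ sg *
    (t (sg (@Ordinal 3 0 isT)) p * t (sg (@Ordinal 3 1 isT)) q
     * t (sg (@Ordinal 3 2 isT)) r).
transitivity ((D u v w - D u w v) - (D v u w - D v w u) + (D w u v - D w v u)).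
  rewrite -!sumrB -big_split; apply: eq_bigr => sg _ /=; rewrite /det3.
  move: (t (sg _)) (t (sg _)) (t (sg _)) ((-1) ^+ sg) => f g h s; ring.
rewrite /D !sum_S3 /det3; move: (t 0%N) (t 1%N) (t 2%N) => f g h; ring.
Qed.

Definition trilin (y : mvec R n) :=
  [/\ forall b c, lin_form (fun a => y [:: a; b; c]),
      forall a c, lin_form (fun b => y [:: a; b; c])
    & forall a b, lin_form (fun c => y [:: a; b; c])].

Lemma trilinE (y : mvec R n) a b c : trilin y -> y [:: a; b; c] =
  \sum_i \sum_j \sum_k y [:: dbasis R i; dbasis R j; dbasis R k] *
    (a i 0 * b j 0 * c k 0).
Proof.
case=> ya yb yc; rewrite {1}(colE_sum a) (lin_form_sum _ _ (ya _ _)).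
apply: eq_bigr => i _; rewrite {1}(colE_sum b) (lin_form_sum _ _ (yb _ _)).
rewrite mulr_sumr; apply: eq_bigr => j _.
rewrite {1}(colE_sum c) (lin_form_sum _ _ (yc _ _)) !mulr_sumr.
by apply: eq_bigr => k _; ring.
Qed.

(** Contracting y with the six products in the determinant gives y on the
    permutations of (th u, th v, th w), and y is alternating.  The factor 6 is
    the one in the definition of the exterior product of three sharp maps. *)
Lemma sharp3E (b : covec R n) (y : mvec R n) u v w
    (th := fun u : 'rV[R]_n => \col_k b [:: ebasis R k; u] : 'cV[R]_n) :
  (forall s, size s != 2%N -> b s = 0) -> trilin y ->
  (forall a b c, y [:: b; a; c] = - y [:: a; b; c]) ->
  (forall a b c, y [:: a; c; b] = - y [:: a; b; c]) ->
  sharp3 b b b y [:: u; v; w] = 6 * y [:: th u; th v; th w].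
Proof.
move=> b2 y3 y12 y23; rewrite /sharp3 (_ : 3`! = 6%N)//.
pose Y p q r := \sum_i \sum_j \sum_k y [:: dbasis R i; dbasis R j; dbasis R k] *
   (b [:: ebasis R i; p] * b [:: ebasis R j; q] * b [:: ebasis R k; r]).
have YE p q r : Y p q r = y [:: th p; th q; th r].
  rewrite trilinE//; do 3 (apply: eq_bigr => ? _); congr (_ * _).
  by rewrite !mxE.
transitivity ((Y u v w - Y u w v) - (Y v u w - Y v w u) + (Y w u v - Y w v u));
  last first.
  rewrite !YE (y12 (th v) (th w) (th u)) (y23 (th v) (th u) (th w)).
  rewrite (y12 (th u) (th w) (th v)) (y23 (th u) (th v) (th w)) (y12 (th u) (th v)).
  ring.
rewrite big_tuple_cons mulr_sumr -!sumrB -big_split; apply: eq_bigr => i _.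
rewrite big_tuple_cons mulr_sumr -!sumrB -big_split; apply: eq_bigr => j _.
rewrite big_tuple_cons mulr_sumr -!sumrB -big_split; apply: eq_bigr => k _.
rewrite big_tuple_nil /=.
pose t m x := b [:: ebasis R (nth i [:: i; j; k] m); x].
transitivity (6^-1 * (y [:: dbasis R i; dbasis R j; dbasis R k] *
  (6 * det3 (t 0%N) (t 1%N) (t 2%N) u v w))); last first.
  rewrite /t /det3 /=.
  move: (y _) (b [:: _; u]) (b [:: _; v]) (b [:: _; w]) => *.
  by field.
rewrite -(sum_S3_det3 t); congr (_ * (_ * _)); apply: eq_bigr => sg _; congr (_ * _).
rewrite ext_wedge111; try by move=> s s1; apply: b2.
by rewrite /insert /t !(tnth_nth i).
Qed.

End Trivector.

(** * The Schouten square of a bivector field *)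

Section Covector3.
Variables (R : realType) (n : nat).

Lemma covec_of_size (xi : 'cV[R]_n) s : size s != 1%N -> covec_of xi s = 0.
Proof. by case: s => [|v []]. Qed.

(** The reversed order is the one in which insertion of a trivector evaluates to
    its value on (a, b, c). *)
Definition covec3 (a b c : 'cV[R]_n) : covec R n :=
  ext_wedge (covec_of c) (ext_wedge (covec_of b) (ext_wedge (covec_of a) (@covec1 R n))).

Lemma wedge_covec1 (a : covec R n) : (forall s, size s != 1%N -> a s = 0) ->
  ext_wedge a (@covec1 R n) = a.
Proof.
move=> a1; apply/funext => s; have [s1|s1] := eqVneq (size s) 1%N; last first.
  by rewrite (a1 s)//; apply: (@ext_wedge_size _ _ 1 0) => // -[].
case: s s1 => [|v []]// _; rewrite ext_wedge_cons !ext_wedge_nil /insert /covec1 /=.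
by rewrite mulr0 mulr1 addr0.
Qed.

Lemma covec3E a b c p q r : covec3 a b c [:: p; q; r] =
  det3 (fun x => (x *m c) 0 0) (fun x => (x *m b) 0 0) (fun x => (x *m a) 0 0) p q r.
Proof.
by rewrite /covec3 wedge_covec1 ?ext_wedge111//; exact: covec_of_size.
Qed.

Lemma covec3_size a b c s : size s != 3%N -> covec3 a b c s = 0.
Proof.
move=> s3; rewrite /covec3 wedge_covec1; last exact: covec_of_size.
apply: (@ext_wedge_size _ _ 1 2) => // t; first exact: covec_of_size.
by apply: (@ext_wedge_size _ _ 1 1); exact: covec_of_size.
Qed.

Lemma covec3_bilin2 a b c : bilin2 (covec3 a b c).
Proof.
have L (xi : 'cV[R]_n) : lin_form (fun v : 'rV[R]_n => (v *m xi) 0 0).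
  by move=> k u v; rewrite mulmxDl -scalemxAl !mxE.
move=> s; have [|s1] := eqVneq (size s) 1%N; last first.
  by split=> v k u u'; rewrite !covec3_size//= ?mulr0 ?addr0.
case: s => [|r []]// _; split=> v k u u'; rewrite !covec3E /det3 !(L _ k u u'); ring.
Qed.

End Covector3.

Section Schouten.
Variables (R : realType) (n : nat) (M : smooth_manifold R n).
Variables (Z : mvfield M).
Hypotheses (hZ : is_mvfield 2 Z).
Variable x : M.
Local Notation e := (ebasis R).
Local Notation i0 := (chart_at x).
Local Notation y0 := (ccoord (chart_at x) x).
Local Notation zeta y i j := (mvfield_in i0 Z y [:: dbasis R i; dbasis R j]).
Local Notation zx i j := (Z x [:: dbasis R i; dbasis R j]).
Local Notation Dz u i j := ('D_u (fun y => zeta y i j) y0).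

Let Z2 y : alternating 2 (Z y). Proof. by case: hZ. Qed.
Let y0_crng := coord_crng_at x.

Lemma ext_d_const w s : ext_d (const_form x w) x s = 0.
Proof.
apply: big1 => j _; set t := take _ _ ++ _.
rewrite (@near_eq_derive _ _ _ _ (cst (w t))) ?derive_cst ?mulr0//.
by apply: filterS (near_crng y0_crng) => y iy; rewrite form_in_const.
Qed.

Lemma derive_iota_const w u q : bilin2 w ->
  'D_u (fun y => form_in i0 (iotaf 2 Z (const_form x w)) y [:: q]) y0 =
  half_sum (fun k l => Dz u k l * w [:: e l; e k; q]).
Proof.
move=> w2.
transitivity ('D_u (fun y => half_sum (fun k l => zeta y k l *
    (cst (w [:: e l; e k; q]) : _ -> R) y)) y0).
  apply: near_eq_derive; apply: filterS (near_crng y0_crng) => y iy.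
  rewrite form_in_iota//; last exact: (bilin2_map (mulmxr _) w2).
  by rewrite form_in_const// insertk2E.
rewrite derive_half_sum; [|by move=> i j; exact: zeta_diff|by []].
by apply: eq_half_sum => i j; rewrite derive_cst mulr0 addr0.
Qed.

(** Since dw = 0 and exact forms have no component of degree 0, only two copies of
    i_Z d i_Z w remain in [L_Z, i_Z] w. *)
Lemma schouten_insert w :
  comm_lie_iota 2 Z 2 Z (const_form x w) x [::] =
  2 * iotaf 2 Z (ext_d (iotaf 2 Z (const_form x w))) x [::].
Proof.
have d0 th : ext_d th x [::] = 0 by rewrite /ext_d big_ord0.
rewrite /comm_lie_iota {1}/lie_der d0 mulr0 subr0.
set a := iotaf 2 Z (ext_d _) x [::].
suff -> : iotaf 2 Z (lie_der 2 Z (const_form x w)) x [::] = - a.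
  by rewrite -signr_odd /= expr0 mul1r opprK mulr_natl mulr2n.
rewrite /a /iotaf !insertk2E -[LHS]/(half_sum _) -[X in - X]/(half_sum _) half_sumN.
apply: eq_half_sum => i j; rewrite -mulrN; congr (_ * _).
rewrite /lie_der -signr_odd /= expr0 mul1r -[RHS]add0r; congr (_ + _).
rewrite /iotaf insertk2E big1 ?mulr0// => k _; rewrite big1// => l _.
by rewrite ext_d_const mulr0.
Qed.

(** (D_u Z)(xi, eta) in the chart selected at x. *)
Definition dbivector (u : 'rV[R]_n) (xi eta : 'cV[R]_n) : R :=
  \sum_k \sum_l Dz u k l * (xi k 0 * eta l 0).

Let Dz_lin k l : lin_form (fun u => Dz u k l).
Proof.
move=> a u v; rewrite !deriveE; try exact: zeta_diff.
exact: linearP.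
Qed.

Lemma Dz_swap u k l : Dz u k l = - Dz u l k.
Proof.
rewrite -deriveN; last exact/diff_derivable/zeta_diff.
congr ('D_u _ y0); apply/funext => y.
by apply: alt2_swap; exact: mvfield_in_alternating.
Qed.

Lemma dbivector_linu xi eta : lin_form (fun u => dbivector u xi eta).
Proof.
move=> a u v; rewrite /dbivector mulr_sumr -big_split; apply: eq_bigr => k _ /=.
rewrite mulr_sumr -big_split; apply: eq_bigr => l _ /=; rewrite Dz_lin.
by move: (Dz _ _ _) (Dz _ _ _) => *; ring.
Qed.

Lemma dbivector_linl u eta : lin_form (fun xi => dbivector u xi eta).
Proof.
move=> a xi xi'; rewrite /dbivector mulr_sumr -big_split; apply: eq_bigr => k _ /=.
rewrite mulr_sumr -big_split; apply: eq_bigr => l _ /=; rewrite !mxE.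
by move: (Dz _ _ _) => *; ring.
Qed.

Lemma dbivector_swap u xi eta : dbivector u eta xi = - dbivector u xi eta.
Proof.
rewrite /dbivector exchange_big -sumrN; apply: eq_bigr => k _ /=.
rewrite -sumrN; apply: eq_bigr => l _; rewrite Dz_swap mulNr.
by rewrite [eta l 0 * _]mulrC.
Qed.

Lemma dbivector_half u xi eta :
  dbivector u xi eta =
  half_sum (fun k l => Dz u k l * (xi k 0 * eta l 0 - xi l 0 * eta k 0)).
Proof.
pose D := \matrix_(k, l) Dz u k l.
have DT : D^T = - D by apply/matrixP => k l; rewrite !mxE Dz_swap.
transitivity (\sum_k \sum_l D k l * (xi k 0 * eta l 0)).
  by apply: eq_bigr => k _; apply: eq_bigr => l _; rewrite mxE.
by rewrite (skew_half_sum _ DT); apply: eq_half_sum => k l; rewrite mxE.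
Qed.

(** (D_(Z^# a) Z)(b, c); see [schouten_termE]. *)
Definition schouten_term (a b c : 'cV[R]_n) :=
  \sum_i \sum_j zx i j * (a i 0 * dbivector (e j) b c).

Lemma schouten_termE a b c :
  schouten_term a b c = dbivector (a^T *m mvec_mx (Z x)) b c.
Proof.
rewrite [X in dbivector X]rowE_sum (lin_form_sum _ _ (dbivector_linu b c)).
rewrite /schouten_term exchange_big; apply: eq_bigr => j _ /=.
by rewrite mxE mulr_suml; apply: eq_bigr => i _; rewrite !mxE mulrCA mulrA.
Qed.

(** In i_Z d i_Z w, the value of w on three basis vectors is a determinant;
    expanding it along the vector inserted by the outer contraction yields the
    three cyclic terms. *)
Lemma half_schoutenE a b c : 2^-1 * schouten 2 Z 2 Z x [:: a; b; c] =
  schouten_term a b c + schouten_term b c a + schouten_term c a b.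
Proof.
have w2 := covec3_bilin2 a b c.
rewrite /schouten -[foldr _ _ _]/(covec3 a b c) schouten_insert//.
rewrite mulKf ?pnatr_eq0// /iotaf insertk2E.
pose H u q := half_sum (fun k l => Dz u k l * covec3 a b c [:: e l; e k; q]).
transitivity (half_sum (fun i j => mvec_mx (Z x) i j * (H (e j) (e i) - H (e i) (e j)))).
  by apply: eq_half_sum => i j; rewrite mxE ext_d2E !derive_iota_const.
rewrite -(skew_half_sum (fun i j => H (e j) (e i)) (mvec_mx_tr (Z2 x))).
rewrite /schouten_term -!big_split; apply: eq_bigr => i _ /=.
rewrite -!big_split; apply: eq_bigr => j _ /=; rewrite mxE -!mulrDr; congr (_ * _).
rewrite !dbivector_half !half_sumMl !half_sumD; apply: eq_half_sum => k l.
have eE (xi : 'cV[R]_n) m : (e m *m xi) 0 0 = xi m 0 by rewrite -rowE mxE.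
by rewrite covec3E /det3 !eE; move: (Dz _ _ _) => *; ring.
Qed.

End Schouten.

(** * The Maurer-Cartan expression *)

Section Gauge.
Variables (R : realType) (n : nat) (M : smooth_manifold R n).
Variables (Z : mvfield M) (b : dform M).
Hypotheses (hZ : is_mvfield 2 Z) (hb : is_form 2 b).
Variable x : M.
Local Notation e := (ebasis R).
Local Notation i0 := (chart_at x).
Local Notation y0 := (ccoord (chart_at x) x).
Local Notation beta y p q := (form_in i0 b y [:: p; q]).
Local Notation zeta y i j := (mvfield_in i0 Z y [:: dbasis R i; dbasis R j]).
Local Notation bx p q := (b x [:: p; q]).
Local Notation zx i j := (Z x [:: dbasis R i; dbasis R j]).
Local Notation Db u p q := ('D_u (fun y => beta y p q) y0).
Local Notation Dz u i j := ('D_u (fun y => zeta y i j) y0).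
Local Notation Q := (dbivector Z x).
Local Notation B := (form_mx (b x)).
Local Notation Zm := (mvec_mx (Z x)).

Let b2 y : alternating 2 (b y). Proof. by case: hb. Qed.
Let Z2 y : alternating 2 (Z y). Proof. by case: hZ. Qed.

(** The covector i_u b. *)
Definition iota_form (u : 'rV[R]_n) : 'cV[R]_n := (u *m B)^T.

Lemma iota_formE u i : iota_form u i 0 = bx u (e i).
Proof. by rewrite [LHS]mxE alt2_mxE// trmx_delta -colE [RHS]mxE. Qed.

(** Z^#(b^#(u)), so that u + sharp_iota u is the image of u under id + Z^# b^#. *)
Definition sharp_iota (u : 'rV[R]_n) : 'rV[R]_n := u *m B *m Zm.

Lemma Db_lin p q : lin_form (fun u => Db u p q).
Proof.
move=> a u v; rewrite !deriveE; try exact: beta_diff.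
exact: linearP.
Qed.

Lemma derive_sharp_iota u p q :
  half_sum (fun i j => zx i j * (bx u (e i) * Db (e j) p q - bx u (e j) * Db (e i) p q))
  = Db (sharp_iota u) p q.
Proof.
rewrite [RHS](congr1 (fun v => Db v p q) (rowE_sum (sharp_iota u)))
  (lin_form_sum _ _ (Db_lin p q)).
transitivity (\sum_i \sum_j Zm i j * (bx u (e i) * Db (e j) p q)).
  rewrite (skew_half_sum _ (mvec_mx_tr (Z2 x))).
  by apply: eq_half_sum => i j; rewrite mxE.
rewrite exchange_big; apply: eq_bigr => j _ /=.
rewrite mxE mulr_suml; apply: eq_bigr => i _.
by rewrite -iota_formE [iota_form u i 0]mxE mulrCA mulrA.
Qed.

Lemma bx_iota_form u j : bx (e j) u = - iota_form u j 0.
Proof. by rewrite iota_formE; exact: alt2_swap. Qed.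

Lemma dbivector_iota_form u v w :
  half_sum (fun i j => Dz u i j * (bx v (e i) * bx (e j) w - bx v (e j) * bx (e i) w))
  = - Q u (iota_form v) (iota_form w).
Proof.
rewrite dbivector_half// half_sumN; apply: eq_half_sum => i j.
rewrite !bx_iota_form -!iota_formE.
by move: (Dz _ _ _) => *; ring.
Qed.

(** v (D_u B - B (D_u Z) B) w^T, see [gauge_termE]: as B is skew, B w^T is
    - i_w b, which makes the second term + (D_u Z)(i_v b, i_w b). *)
Definition gauge_term u v w : R := Db u v w + Q u (iota_form v) (iota_form w).

Lemma gauge_term_lin v w : lin_form (fun u => gauge_term u v w).
Proof.
apply: (lin_form_add (Db_lin v w)).
exact: (dbivector_linu hZ x (iota_form v) (iota_form w)).
Qed.

Lemma gauge_term_swap u v w : gauge_term u w v = - gauge_term u v w.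
Proof. by rewrite /gauge_term (Db_swap hb) dbivector_swap// opprD. Qed.

Lemma half_sum_lambda2 (z zu zv zw : 'I_n -> 'I_n -> R)
    (X1 X2 X3 Y1 Y2 Y3 : 'I_n -> 'I_n -> R) :
  half_sum (fun i j => z i j * (X1 i j + X2 i j + X3 i j) - zu i j * Y1 i j
    - zv i j * Y2 i j - zw i j * Y3 i j) =
  half_sum (fun i j => z i j * X1 i j) + half_sum (fun i j => z i j * X2 i j)
  + half_sum (fun i j => z i j * X3 i j) - half_sum (fun i j => zu i j * Y1 i j)
  - half_sum (fun i j => zv i j * Y2 i j) - half_sum (fun i j => zw i j * Y3 i j).
Proof.
by rewrite !(half_sumN, half_sumD); apply: eq_half_sum => i j; rewrite !mulrDr.
Qed.

Lemma lambda2_iota_form u v w : 2^-1 * lambda2 Z 2 b b x [:: u; v; w] =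
  Db (sharp_iota u) v w + Db (sharp_iota v) w u + Db (sharp_iota w) u v
  + (Q u (iota_form v) (iota_form w) + Q v (iota_form w) (iota_form u)
     + Q w (iota_form u) (iota_form v)).
Proof.
rewrite lambda2E// half_sum_lambda2 !derive_sharp_iota !dbivector_iota_form.
by rewrite !opprK !addrA.
Qed.

Lemma trilin_half_schouten :
  trilin (fun xis => 2^-1 * schouten 2 Z 2 Z x xis).
Proof.
have t1 d c : lin_form (fun a => schouten_term Z x a d c).
  move=> k u v; rewrite !schouten_termE// linearP mulmxDl -scalemxAl.
  exact: dbivector_linu.
have t2 a c : lin_form (fun d => schouten_term Z x a d c).
  by move=> k u v; rewrite !schouten_termE//; exact: dbivector_linl.
have t3 a d : lin_form (fun c => schouten_term Z x a d c).
  move=> k u v; rewrite !schouten_termE// !(dbivector_swap hZ x _ _ d).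
  by rewrite dbivector_linl; do ?[move: (Q _ _ _) => ?]; ring.
move: (schouten 2 Z 2 Z x) (half_schoutenE hZ x) => Y YE.
split=> c d k u v; rewrite !YE.
- exact: (lin_form_add (lin_form_add (t1 c d) (t3 c d)) (t2 d c) k u v).
- exact: (lin_form_add (lin_form_add (t2 c d) (t1 d c)) (t3 d c) k u v).
exact: (lin_form_add (lin_form_add (t3 c d) (t2 d c)) (t1 c d) k u v).
Qed.

Lemma half_schouten_iota_form a d c : 2^-1 * schouten 2 Z 2 Z x [:: a; d; c] =
  Q (a^T *m Zm) d c + Q (d^T *m Zm) c a + Q (c^T *m Zm) a d.
Proof. by rewrite half_schoutenE// !schouten_termE. Qed.

Lemma lambda3_iota_form u v w : 6^-1 * lambda3 Z 2 b b b x [:: u; v; w] =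
  Q (sharp_iota u) (iota_form v) (iota_form w)
  + Q (sharp_iota v) (iota_form w) (iota_form u)
  + Q (sharp_iota w) (iota_form u) (iota_form v).
Proof.
have y3 := trilin_half_schouten.
have YE := half_schouten_iota_form.
rewrite /lambda3; move: (schouten 2 Z 2 Z x) y3 YE => Y y3 YE.
rewrite sharp3E//; first last.
- move=> a c d; rewrite !YE (dbivector_swap hZ x _ c d) (dbivector_swap hZ x _ a c).
  by rewrite (dbivector_swap hZ x _ a d); do ?[move: (Q _ _ _) => ?]; ring.
- move=> a c d; rewrite !YE (dbivector_swap hZ x _ c d) (dbivector_swap hZ x _ a c).
  by rewrite (dbivector_swap hZ x _ a d); do ?[move: (Q _ _ _) => ?]; ring.
- exact: alt2_size.
have thE (t : 'rV[R]_n) : \col_k b x [:: e k; t] = - iota_form t.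
  by apply/colP => k; rewrite [LHS]mxE [RHS]mxE bx_iota_form.
rewrite !thE; case: y3 => l1 l2 l3.
rewrite (lin_formN _ (l1 _ _)) (lin_formN _ (l2 _ _)) (lin_formN _ (l3 _ _)).
rewrite YE /iota_form !trmxK -/(sharp_iota _).
do ?[move: (Q _ _ _) => ?].
by rewrite -signr_odd /=; field.
Qed.

(** The three homogeneous parts recombine because [gauge_term] is linear in its
    direction: u carries db and the derivative of Z in the bracket, while
    Z^#(b^#(u)) carries the derivative of b in the bracket and the cubic term. *)
Lemma maurer_cartanE u v w :
  lambda1 b x [:: u; v; w] + 2^-1 * lambda2 Z 2 b b x [:: u; v; w]
    + 6^-1 * lambda3 Z 2 b b b x [:: u; v; w] =
  gauge_term (u + sharp_iota u) v w + gauge_term (v + sharp_iota v) w u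
    + gauge_term (w + sharp_iota w) u v.
Proof.
rewrite lambda2_iota_form lambda3_iota_form /lambda1 ext_d3E.
rewrite !(lin_formD _ _ (gauge_term_lin _ _)) /gauge_term (Db_swap hb x v).
do ?[move: (Q _ _ _) => ?].
do ?[move: (Db _ _ _) => ?].
ring.
Qed.

End Gauge.

(** * Closedness of the transformed form *)

Section GaugeTransform.
Variables (R : realType) (n : nat) (M : smooth_manifold R n).
Variables (Z : mvfield M) (b : dform M).
Hypotheses (hZ : is_mvfield 2 Z) (hb : is_form 2 b).
Hypothesis hI : forall y, I_fiber (Z y) (b y).
Variable x : M.
Local Notation i0 := (chart_at x).
Local Notation y0 := (ccoord (chart_at x) x).
Local Notation B := (form_mx (b x)).
Local Notation Zm := (mvec_mx (Z x)).
Local Notation A := (1%:M + B *m Zm).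
Local Notation Bf := (fun y => form_mx (form_in i0 b y)).
Local Notation Zf := (fun y => mvec_mx (mvfield_in i0 Z y)).
Local Notation gauge_term := (gauge_term Z b x).

Let b2 y : alternating 2 (b y). Proof. by case: hb. Qed.
Let Z2 y : alternating 2 (Z y). Proof. by case: hZ. Qed.

Lemma Bf_diff : mx_differentiable y0 Bf.
Proof. by move=> i j; under eq_fun do rewrite mxE; exact: beta_diff. Qed.

Lemma Zf_diff : mx_differentiable y0 Zf.
Proof. by move=> i j; under eq_fun do rewrite mxE; exact: zeta_diff. Qed.

Lemma gauge_unit : \forall y \near y0, 1%:M + Bf y *m Zf y \in unitmx.
Proof.
apply: filterS (near_crng (coord_crng_at x)) => y iy.
have [_] := hI (cparam i0 y); rewrite id_plusE// => Au.
by rewrite /= (gauge_mx_in iy (Z2 _) (b2 _)) (unitmx_conj _ (jac_toK iy)).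
Qed.

Lemma gauge_termE k v w : gauge_term k v w =
  (v *m ('D_k Bf y0 - B *m 'D_k Zf y0 *m B) *m w^T) 0 0.
Proof.
rewrite mulmxBr mulmxBl [RHS]mxE; congr (_ + _).
  rewrite -mx_derive_pair; last exact: Bf_diff.
  congr ('D_k _ y0); apply/funext => y; apply: alt2_mxE.
  exact: form_in_alternating.
transitivity ((v *m B *m 'D_k Zf y0 *m (w *m B)^T) 0 0).
  rewrite mx_pair; apply: eq_bigr => i _; apply: eq_bigr => j _.
  rewrite mx_deriveE; last exact: Zf_diff.
  rewrite ![iota_form _ _ _ _ _]mxE.
  under [in RHS]eq_fun do rewrite mxE.
  by rewrite mulrCA mulrA.
by rewrite trmx_mul form_mx_tr// mulNmx mulmxN !mulmxA [LHS]mxE [RHS]mxE.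
Qed.

(** Evaluating on vA and wA absorbs the factors A and 1 + ZB = A^T that
    [derive_gauge] produces. *)
Lemma derive_F k v w :
  'D_k (fun y => form_in i0 (F_form Z b) y [:: v *m A; w *m A]) y0 = gauge_term k v w.
Proof.
rewrite gauge_termE.
have := derive_gauge Bf_diff Zf_diff gauge_unit k v w^T.
rewrite form_in_at mvfield_in_at => <-.
apply: near_eq_derive; apply: filterS (near_crng (coord_crng_at x)) => y iy.
rewrite form_in_F//; congr (fun_of_matrix (_ *m _) 0 0).
rewrite trmx_mul linearD /= trmx1 trmx_mul mvec_mx_tr// form_mx_tr//.
by rewrite mulmxN mulNmx opprK.
Qed.

Lemma mulmx_gauge u : u *m A = u + sharp_iota Z b x u.
Proof. by rewrite mulmxDr mulmx1 mulmxA. Qed.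

(** The identity from which the theorem follows: up to the change of vectors
    A, the differential of F(b) is the Maurer-Cartan expression of b. *)
Lemma ext_d_F u v w : ext_d (F_form Z b) x [:: u *m A; v *m A; w *m A] =
  lambda1 b x [:: u; v; w] + 2^-1 * lambda2 Z 2 b b x [:: u; v; w]
    + 6^-1 * lambda3 Z 2 b b b x [:: u; v; w].
Proof.
rewrite maurer_cartanE// ext_d3E !derive_F !mulmx_gauge.
by rewrite (gauge_term_swap hZ hb _ (v + _)) opprK.
Qed.

Lemma F_degree : of_degree 2 (F_form Z b).
Proof. by move=> y [|v [|w []]]. Qed.

End GaugeTransform.

(** * Openness of the domain of the transformation *)

Section Openness.
Variables (R : realType) (n : nat) (M : smooth_manifold R n).
Variables (Z : mvfield M).
Hypotheses (hZ : is_mvfield 2 Z).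

Lemma covec_of_mx_size (B : 'M[R]_n) s : size s != 2%N -> covec_of_mx B s = 0.
Proof. by case: s => [|v [|w []]]. Qed.

Lemma covec_of_mx_alternating (B : 'M[R]_n) : B^T = - B -> alternating 2 (covec_of_mx B).
Proof.
move=> BT; split=> [[|v [|w []]]//|s1 s2 a u v|s1 s2 s3 u].
- case: s1 => [|p [|q [|r s1]]]; case: s2 => [|p' [|q' s2]];
    rewrite /= ?mulr0 ?addr0//.
    by rewrite !mulmxDl -!scalemxAl !mxE.
  by rewrite linearD linearZ /= mulmxDr -scalemxAr !mxE.
- have [|sN] := eqVneq (size (s1 ++ u :: s2 ++ u :: s3)) 2%N; last first.
    by apply: covec_of_mx_size.
  rewrite !size_cat /= size_cat /= !addnS => -[] /eqP.
  rewrite !addn_eq0 !size_eq0 => /and3P[/eqP-> /eqP-> /eqP->] /=.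
  apply/eqP; rewrite -eqNr [X in _ == X]mx_pair_tr BT mulmxN mulNmx.
  by rewrite [X in _ == X]mxE.
Qed.

Lemma form_mx_covec_of_mx (B : 'M[R]_n) : form_mx (covec_of_mx B) = B.
Proof.
apply/matrixP => i j; rewrite [LHS]mxE /= trmx_delta -colE mxE -rowE mxE //.
Qed.

(** [gauge_mx_in] applied to any 2-form with this value at the point: the two
    sides are conjugate endomorphisms. *)
Lemma I_fiber_chart (i : chart M) y B : crng i y -> B^T = - B ->
  I_fiber (Z (cparam i y)) (fun s =>
    covec_of_mx B [seq v *m jac_at (cparam i y) i | v <- s]) <->
  \det (1%:M + B *m mvec_mx (mvfield_in i Z y)) != 0.
Proof.
move=> iy BT; set c := fun s => _.
have Z2 := hZ.1 (cparam i y).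
have c2 : alternating 2 c.
  exact: (@alternating_map _ _ _ (mulmxr (jac_at (cparam i y) i)) _ _
    (covec_of_mx_alternating BT)).
have cE : form_in i (fun=> c) y = covec_of_mx B.
  apply/funext => s; rewrite /form_in /c -map_comp.
  rewrite -[RHS](congr1 (covec_of_mx B) (map_id s)); congr covec_of_mx.
  by apply: eq_map => v /=; rewrite -mulmxA jac_toK// mulmx1.
have := @gauge_mx_in _ _ _ i Z (fun=> c) y iy Z2 c2.
rewrite cE form_mx_covec_of_mx => E; rewrite -unitfE -unitmxE E.
rewrite (unitmx_conj _ (jac_toK iy)) -id_plusE//.
by split=> [[]|].
Qed.

Lemma I_fiber_open : wedge2_open (fun x => I_fiber (Z x)).
Proof.
move=> i /= y B iy BT /(I_fiber_chart iy BT) d0.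
pose f (p : 'rV[R]_n * 'M[R]_n) := 1%:M + p.2 *m mvec_mx (mvfield_in i Z p.1).
have df : mx_differentiable (y, B) f.
  apply: mx_differentiableD; first exact: mx_differentiable_cst.
  apply: mx_differentiableM => k l.
    apply: (@differentiable_comp _ _ _ _ snd (fun C : 'M[R]_n => C k l)).
      apply: linear_differentiable; move=> p; exact: cvg_snd.
    exact: differentiable_coord.
  under eq_fun do rewrite mxE.
  apply: (@differentiable_comp _ _ _ _ fst
    (fun z => mvfield_in i Z z [:: dbasis R k; dbasis R l])).
    apply: linear_differentiable; move=> p; exact: cvg_fst.
  by case: hZ => _ /(_ i [:: dbasis R k; dbasis R l] 1%N) [+ _]; apply.
have /differentiable_continuous/cvgr_neq0 := differentiable_det df.
move=> /(_ d0) near_d0.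
by apply: filterS near_d0 => -[y' B'] /= d0' iy' BT'; exact/(I_fiber_chart iy' BT').
Qed.

End Openness.

Unset Implicit Arguments.

Theorem corollary3p9 (R : realType) (n : nat) (M : smooth_manifold R n)
    (Z : mvfield M) (hZ : is_mvfield 2 Z) :
  exists U : forall x : M, set (covec R n),
    [/\ forall x, U x `<=` I_fiber (Z x),
        wedge2_open U,
        forall x, U x (fun _ => 0)
      & forall b : dform M, is_form 2 b -> (forall x, U x (b x)) ->
          (maurer_cartan Z b <-> closed_form (F_form Z b))].
Proof.
exists (fun x => I_fiber (Z x)); split=> [x|||]; [by []|exact: I_fiber_open| |].
  move=> x; have Z2 := hZ.1 x.
  have c2 : alternating 2 (fun _ : seq 'rV[R]_n => 0 : R).
    by split=> // s1 s2 a u v; rewrite mulr0 addr0.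
  split=> //; rewrite id_plusE// (_ : form_mx _ = 0); last first.
    by apply/matrixP => i j; rewrite !mxE.
  by rewrite mul0mx addr0 unitmx1.
move=> b hb hI.
have bd : of_degree 2 b by apply: alternating_degree; case: hb.
have Au x : 1%:M + form_mx (b x) *m mvec_mx (Z x) \in unitmx.
  by rewrite -id_plusE; [case: (hI x)|exact: hZ.1|exact: hb.1].
split=> [mc x s|cl x s].
- have [|s3] := eqVneq (size s) 3%N; last exact: (ext_d_degree (@F_degree _ _ _ Z b)).
  case: s => [|u [|v [|w []]]]// _.
  rewrite -(mulmxKV (Au x) u) -(mulmxKV (Au x) v) -(mulmxKV (Au x) w).
  by rewrite ext_d_F// mc.
have [|s3] := eqVneq (size s) 3%N; last first.
  rewrite /lambda1 (ext_d_degree bd)// lambda2_degree// lambda3_degree//.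
  by rewrite !mulr0 !addr0.
case: s => [|u [|v [|w []]]]// _.
by rewrite -ext_d_F// cl.
Qed.
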